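(* Let $\mathcal D=D(0,1)\setminus\bigcup_{j=1}^s\overline{D(c_j,r_j)}$ be a circular multiply connected domain (CMCD). The series $\sum_{\tau\in\mathcal T}|\tau'(z)|$ converges locally uniformly on $D(0,\rho_a^{-1})$ (that is, $\mathcal D$ satisfies Assumption A) whenever $\mathcal D$ satisfies any one of the following conditions: (i) $c_j\in(-1,1)$ for each $j\in\{1,\dots,s\}$; (ii) $\displaystyle\sum_{j=1}^s\frac{r_j^2}{(1-|c_j|\rho_a)^2}<1$; (iii) $\mathcal D=\Psi(\tilde{\mathcal D})$, where $\tilde{\mathcal D}$ is a CMCD that satisfies Assumption A and $\Psi$ is an automorphism of the unit disk. In particular, this is the case for any $\mathcal D$ with one or two removed disks ($s=1,2$).
   Context: Notation: $D(c,r)=\{z\in\mathbb C:|z-c|<r\}$. A circular multiply connected domain (CMCD) is a domain $\mathcal D=D(0,1)\setminus\bigcup_{j=1}^s\overline{D(c_j,r_j)}$ with $s\ge1$, $r_j>0$, where the closed disks $\overline{D(c_j,r_j)}$ are contained in $D(0,1)$ and pairwise disjoint. For each $j$ there is a unique pair $a_j\in D(0,1)$, $\sigma_j\in(0,1)$ such that $\Phi_j(z)=\frac{\overline{a_j}}{|a_j|}\frac{z-a_j}{1-\overline{a_j}z}$ maps $D(c_j,r_j)$ onto $D(0,\sigma_j)$ (if $a_j=0$, the factor $\overline{a_j}/|a_j|$ is read as $1$). Put $\rho_a=\max_j|a_j|$ (with $\rho_a^{-1}=\infty$ if $\rho_a=0$) and $T_j(z)=\Phi_j^{-1}(\sigma_j^2\Phi_j(z))$,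 $z\in\overline{\mathbb C}$. Let $\mathcal T^*$ be the family of all finite compositions $T_{j_n}T_{j_{n-1}}\cdots T_{j_1}$, $n\ge1$, $j_k\in\{1,\dots,s\}$, and $\mathcal T=\mathcal T^*\cup\{T_0\}$ with $T_0(z)\equiv z$. Every $\tau\in\mathcal T$ is analytic in $D(0,\rho_a^{-1})$. Assumption A (for a CMCD): the series $\sum_{\tau\in\mathcal T}|\tau'(z)|$ converges locally uniformly on $D(0,\rho_a^{-1})$. *)

(* Defs.v *)
From HB Require Import structures.
From mathcomp Require Import all_boot all_order all_algebra.
From mathcomp Require Import all_classical all_reals all_analysis.
From mathcomp Require Import complex ring.

Set Implicit Arguments.
Unset Strict Implicit.
Unset Printing Implicit Defensive.

Import Order.TTheory GRing.Theory Num.Theory.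
Import numFieldNormedType.Exports.
Import ComplexField ComplexField.Normc.

Local Open Scope classical_set_scope.
Local Open Scope ring_scope.
Local Open Scope complex_scope.

(* [R[i]] carries the order and norm of a numFieldType, so [`|z|] is again in
   [R[i]]; [normc z : R] is the same modulus as a real number. *)

Definition disk (R : realType) (c : R[i]) (r : R) : set R[i] :=
  [set z | normc (z - c) < r].

Definition cdisk (R : realType) (c : R[i]) (r : R) : set R[i] :=
  [set z | normc (z - c) <= r].

(* Data of a circular multiply connected domain; as a set the domain is
   [domain D] below. *)
Record cmcd (R : realType) := Cmcd {
  holes : nat;
  center : 'I_holes -> R[i];
  radius : 'I_holes -> R;
  holes_gt0 : (0 < holes)%N;
  radius_gt0 : forall j, 0 < radius j;
  hole_sub : forall j, cdisk (center j) (radius j) `<=` disk 0 1;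
  hole_disj : forall i j, i != j ->
    cdisk (center i) (radius i) `&` cdisk (center j) (radius j) = set0 }.

Arguments center {R} _ _.
Arguments radius {R} _ _.

Definition domain (R : realType) (D : cmcd R) : set R[i] :=
  disk 0 1 `\` \bigcup_(j in [set: 'I_(holes D)])
                  cdisk (center D j) (radius D j).

Definition unimod (R : realType) (a : R[i]) : R[i] :=
  if a == 0 then 1 else a^* / (normc a)%:C.

Definition Phi (R : realType) (a z : R[i]) : R[i] :=
  unimod a * ((z - a) / (1 - a^* * z)).

(* The inverse Moebius transformation of [Phi a]; see [PhiK] and [Phi_invK]. *)
Definition Phi_inv (R : realType) (a w : R[i]) : R[i] :=
  (w / unimod a + a) / (1 + a^* * (w / unimod a)).

Lemma unimod_neq0 (R : realType) (a : R[i]) : unimod a != 0.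
Proof.
rewrite /unimod; case: (eqVneq a) => [_|a0]; first exact: oner_neq0.
have na0 : `|a| != 0 by rewrite normr_eq0.
by rewrite mulf_neq0 ?invr_eq0 // conjc_eq0.
Qed.

Lemma disk_conj_neq1 (R : realType) (a : R[i]) :
  disk 0 1 a -> 1 - a^* * a != 0.
Proof.
rewrite /disk /= subr0 => a1; rewrite mulrC -sqr_normc subr_eq0 eq_sym.
by rewrite lt_eqF // exprn_ilt1 // (_ : `|a| = (normc a)%:C) // ltcR.
Qed.

Lemma PhiK (R : realType) (a z : R[i]) : disk 0 1 a ->
  1 - a^* * z != 0 -> Phi_inv a (Phi a z) = z.
Proof.
move=> /disk_conj_neq1 a1 z1; rewrite /Phi_inv /Phi.
rewrite [unimod a * _]mulrC mulfK ?unimod_neq0 //.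
move: (a^*)%R a1 z1 => b a1 z1; field.
by rewrite z1 /= (_ : _ + _ = 1 - b * a) //; ring.
Qed.

Lemma Phi_invK (R : realType) (a w : R[i]) : disk 0 1 a ->
  1 + a^* * (w / unimod a) != 0 -> Phi a (Phi_inv a w) = w.
Proof.
move=> /disk_conj_neq1 a1 w1; rewrite /Phi_inv /Phi.
rewrite -[RHS](divfK (unimod_neq0 a)) mulrC; congr (_ * _).
move: (w / unimod a) (a^*)%R w1 a1 => v b w1 a1; field.
by rewrite w1 /= (_ : _ - _ = 1 - b * a) //; ring.
Qed.

(* The defining property of the pair (a_j, sigma_j). *)
Definition uniformizing (R : realType) (D : cmcd R) (j : 'I_(holes D))
    (p : R[i] * R) : Prop :=
  [/\ disk 0 1 p.1, 0 < p.2, p.2 < 1 &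
      Phi p.1 @` disk (center D j) (radius D j) = disk 0 p.2].

(* Exactly one pair is [uniformizing], so the choice made by [xget] is
   immaterial and its default value is never used. *)
Definition a_sigma (R : realType) (D : cmcd R) (j : 'I_(holes D)) : R[i] * R :=
  xget (0, 0) [set p | uniformizing j p].

Definition a_ (R : realType) (D : cmcd R) (j : 'I_(holes D)) : R[i] :=
  (a_sigma j).1.

Definition sigma_ (R : realType) (D : cmcd R) (j : 'I_(holes D)) : R :=
  (a_sigma j).2.

Definition rho (R : realType) (D : cmcd R) : R :=
  \big[Num.max/0]_(j < holes D) normc (a_ j).

(* The disk D(0, 1/rho), the whole plane when rho = 0. *)
Definition bigdisk (R : realType) (D : cmcd R) : set R[i] :=
  if rho D == 0 then setT else disk 0 (rho D)^-1.

(* The Moebius transformation T_j, as a function on the plane.  On [bigdisk D],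
   which T_j maps into itself, no denominator of [Phi] or [Phi_inv] vanishes, so
   the convention [x / 0 = 0] affects neither the values of the maps in
   [Tfam D] there nor their derivatives. *)
Definition T_ (R : realType) (D : cmcd R) (j : 'I_(holes D)) (z : R[i]) : R[i] :=
  Phi_inv (a_ j) ((sigma_ j ^+ 2)%:C * Phi (a_ j) z).

(* For the word [:: j_n; ...; j_1], the composition T_{j_n} ... T_{j_1}. *)
Definition Tword (R : realType) (D : cmcd R) (w : seq 'I_(holes D)) :
    R[i] -> R[i] :=
  foldr (fun j f => T_ j \o f) id w.

Definition Tstar (R : realType) (D : cmcd R) : set (R[i] -> R[i]) :=
  [set tau | exists2 w : seq 'I_(holes D), (0 < size w)%N & tau = Tword w].

Definition Tfam (R : realType) (D : cmcd R) : set (R[i] -> R[i]) :=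
  Tstar D `|` [set id].

(* [R[i]^o] is the normed [R[i]]-module R[i]: these are complex derivatives. *)
Definition cderivable (R : realType) (f : R[i] -> R[i]) (z : R[i]) : Prop :=
  derivable (f : R[i]^o -> R[i]^o) z 1.

Definition cderive (R : realType) (f : R[i] -> R[i]) (z : R[i]) : R[i] :=
  'D_1 (f : R[i]^o -> R[i]^o) z.

(* Unordered series [\sum_(i in A) f i z], locally uniformly convergent on the
   open set [Omega]: near each point of [Omega] the finite partial sums
   converge uniformly to a common sum [S] along the net of finite subsets of
   [A]. *)
Definition loc_unif_cvg_series (R : realType) (I : choiceType) (Omega : set R[i])
    (A : set I) (f : I -> R[i] -> R) : Prop :=
  exists S : R[i] -> R, forall z0, Omega z0 ->
    exists2 delta : R, 0 < delta &
      forall eps : R, 0 < eps ->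
        exists F : set I, [/\ finite_set F, F `<=` A &
          forall G : set I, finite_set G -> F `<=` G -> G `<=` A ->
            forall z, disk z0 delta z -> Omega z ->
              `| \sum_(i \in G) f i z - S z | < eps].

Definition assumptionA (R : realType) (D : cmcd R) : Prop :=
  loc_unif_cvg_series (bigdisk D) (Tfam D)
    (fun tau z => normc (cderive tau z)).

Definition disk_automorphism (R : realType) (Psi : R[i] -> R[i]) : Prop :=
  exists Psi' : R[i] -> R[i],
    [/\ {homo Psi : z / disk 0 1 z}, {homo Psi' : z / disk 0 1 z},
        {in disk 0 1, cancel Psi Psi'}, {in disk 0 1, cancel Psi' Psi} &
        forall z, disk 0 1 z -> cderivable Psi z /\ cderivable Psi' z].

Definition condition_i (R : realType) (D : cmcd R) : Prop :=
  forall j : 'I_(holes D), exists2 x : R, -1 < x < 1 & center D j = x%:C.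

Definition condition_ii (R : realType) (D : cmcd R) : Prop :=
  \sum_(j < holes D)
    radius D j ^+ 2 / (1 - normc (center D j) * rho D) ^+ 2 < 1.

Definition condition_iii (R : realType) (D : cmcd R) : Prop :=
  exists (D' : cmcd R) (Psi : R[i] -> R[i]),
    [/\ assumptionA D', disk_automorphism Psi & domain D = Psi @` domain D'].

(* Main.v *)
(* On D(0, 1/rho) one has T_j z = c_j + r_j^2 z / (1 - conj(c_j) z), and a word
   T satisfies T z - T w = (z - w) d(z) d(w) with d^2 = T' and 1/d affine.  Since T
   has no pole in D(0, 1/rho), |T'(z)| <= |T'(0)| / (1 - rho |z|)^2: Assumption A
   reduces to the summability of |T'(0)| over all words, which are pairwise
   distinct because the holes are disjoint.
   (ii) The words of length n contribute at most q^n on |z| <= rho, a disk that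
   every T_j preserves.
   (i) The T_j act as increasing maps of [-1, 1]; a gap to the right of all holes
   has non-overlapping images under all words, with total length at most 2.
   (iii) An automorphism of the disk is a Moebius map; it matches the holes of the
   two domains, hence conjugates their maps T_j, and it is bi-Lipschitz.  That it
   is Moebius follows from the Schwarz-Pick inequality, proved by Goursat's theorem
   in polar coordinates: the means of f(z)/z over circles are constant.
   With at most two holes, a Moebius map makes a_1 = 0 and a_2 real: case (i). *)

From mathcomp Require Import all_boot all_order all_algebra.
From mathcomp Require Import all_classical all_reals all_analysis.
From mathcomp Require Import complex ring lra.
Require Import Defs.

Set Implicit Arguments.
Unset Strict Implicit.
Unset Printing Implicit Defensive.

Import Order.TTheory GRing.Theory Num.Theory.
Import numFieldNormedType.Exports.
Import ComplexField ComplexField.Normc.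

Local Open Scope classical_set_scope.
Local Open Scope ring_scope.
Local Open Scope complex_scope.

(** Increments are easier to control than derivatives, because the formula for T z - T w is an exact
    identity. With real centers, the length of the image of a fixed gap therefore measures |T'(0)|;
    in (iii) the distance between the images of two fixed points is carried across the automorphism
    without any chain rule. Each comparison costs a distortion factor, and what matters is that this
    factor is the same for all words. The automorphism in (iii) is only known to be complex
    differentiable at each point. In logarithmic coordinates a circle around 0 becomes a vertical
    segment of height 2 pi and the singularity of f(z)/z recedes to infinity, so that Goursat on
    rectangles suffices. This yields |f'(0)| <= 1 only. The bound |f(z)| <= |z| then comes from
    integrating the invariant form of that inequality along a radius, and the equality case from the
    preservation of inner products; these two steps stand in for the maximum principle. *)

Local Notation Re := (@complex.Re _).
Local Notation Im := (@complex.Im _).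

(* [conjc] and [Num.conj] compete for this notation; here it is [Num.conj]. *)
Local Notation "x ^*" := (Num.conj x) : complex_scope.

(** * The real-valued modulus and inclusions of disks *)

Section Modulus.
Variable R : realType.
Implicit Types (a c z w : R[i]) (r s t : R).

Lemma conjcM z w : (z * w)^* = z^* * w^*. Proof. exact: rmorphM. Qed.

Lemma conjcB z w : (z - w)^* = z^* - w^*. Proof. exact: rmorphB. Qed.

Lemma conjcV z : (z^-1)^* = (z^*)^-1. Proof. exact: fmorphV. Qed.

Lemma conjcR t : (t%:C)^* = t%:C.
Proof. by rewrite /Num.conj /= oppr0. Qed.

Lemma normc_ge0 z : 0 <= normc z.
Proof. by case: z => x y; exact: sqrtr_ge0. Qed.

Lemma normc_eq0 z : (normc z == 0) = (z == 0).
Proof. by apply/eqP/eqP => [/eq0_normc|->] //; exact: normc0. Qed.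

Lemma normc_gt0 z : (0 < normc z) = (z != 0).
Proof. by rewrite lt_def normc_ge0 andbT normc_eq0. Qed.

Lemma sqr_normcE z : normc z ^+ 2 = Re z ^+ 2 + Im z ^+ 2.
Proof. by case: z => x y; rewrite sqr_sqrtr // addr_ge0 ?sqr_ge0. Qed.

Lemma normc_le_sqr z t : 0 <= t -> (normc z <= t) = (normc z ^+ 2 <= t ^+ 2).
Proof. by move=> t0; rewrite ler_sqr ?nnegrE ?normc_ge0. Qed.

Lemma normc_lt_sqr z t : 0 <= t -> (normc z < t) = (normc z ^+ 2 < t ^+ 2).
Proof. by move=> t0; rewrite ltr_sqr ?nnegrE ?normc_ge0. Qed.

Lemma normc_conj z : normc z^* = normc z.
Proof. by case: z => x y; rewrite /= sqrrN. Qed.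

Lemma normc_real t : normc (t%:C) = `|t|.
Proof. by rewrite /= expr0n addr0 sqrtr_sqr. Qed.

Lemma normc_realp t : 0 <= t -> normc (t%:C) = t.
Proof. by move=> t0; rewrite normc_real ger0_norm. Qed.

Lemma Re_le_normc z : Re z <= normc z.
Proof.
apply: le_trans (ler_norm _) _; rewrite -sqrtr_sqr; case: z => x y /=.
by rewrite ler_sqrt ?addr_ge0 ?sqr_ge0 // lerDl sqr_ge0.
Qed.

Lemma normcB_ge z w : normc z - normc w <= normc (z - w).
Proof. by rewrite lerBlDr -{1}[z](subrK w) le_normcD. Qed.

Lemma normcBC z w : normc (z - w) = normc (w - z).
Proof. by rewrite -normcN opprB. Qed.

Lemma le_normc_triangle z w v : normc (z - w) <= normc (z - v) + normc (v - w).
Proof. by rewrite -[z - w](subrKA v) le_normcD. Qed.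

Lemma mul_conj z : z * z^* = (normc z ^+ 2)%:C.
Proof.
by case: z => x y; rewrite sqr_normcE; simpc => /=; rewrite [y * x]mulrC addNr.
Qed.

Lemma mulconj z : z^* * z = (normc z ^+ 2)%:C.
Proof. by rewrite mulrC mul_conj. Qed.

Lemma one_sub_neq0 c z : normc c * normc z < 1 -> 1 - c * z != 0.
Proof.
move=> h; rewrite subr_eq0; apply/eqP => /(congr1 (@normc R)).
rewrite normcM normc1 => e; by rewrite -e ltxx in h.
Qed.

Lemma one_sub_normc_ge c z : 1 - normc c * normc z <= normc (1 - c * z).
Proof. by rewrite -normcM; have := normcB_ge 1 (c * z); rewrite normc1. Qed.

Lemma one_sub_normc_le c z : normc (1 - c * z) <= 1 + normc c * normc z.
Proof. by rewrite -normcM -[normc (c * z)]normcN -normc1 le_normcD. Qed.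

Lemma normc_unimod a : normc (unimod a) = 1.
Proof.
rewrite /unimod; case: eqVneq => [_|a0]; first exact: normc1.
rewrite normcM normcV normc_conj normc_realp ?normc_ge0 //.
by rewrite divff // normc_eq0.
Qed.

Lemma unimodM a : unimod a * a = (normc a)%:C.
Proof.
rewrite /unimod; case: eqVneq => [->|a0]; first by rewrite mulr0 normc0.
rewrite mulrAC mulconj -rmorphV ?unitfE ?normc_eq0 //.
by rewrite -rmorphM expr2 mulfK // normc_eq0.
Qed.

(** The equality case of the triangle inequality. With [z] the difference of two centers, it gives
    the point of a disk that is farthest from the other center, which turns inclusions of disks into
    inequalities. *)
Lemma exists_dir z t : 0 <= t ->
  exists2 e : R[i], normc e = t & normc (z + e) = normc z + t.
Proof.
move=> t0; exists ((unimod z)^-1 * t%:C).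
  by rewrite normcM normcV normc_unimod invr1 mul1r normc_realp.
have u0 := unimod_neq0 z.
rewrite -{1}[z](mulKf u0) unimodM -mulrDr normcM normcV normc_unimod invr1 mul1r.
by rewrite -rmorphD normc_realp // addr_ge0 // normc_ge0.
Qed.

Lemma cdisk_subP c c' r r' : 0 <= r ->
  (cdisk c r `<=` cdisk c' r') -> normc (c - c') + r <= r'.
Proof.
move=> r0 sub; have [e er <-] := exists_dir (c - c') r0.
have := sub (c + e); rewrite /cdisk /= (_ : c + e - c = e); last by ring.
by rewrite er lexx addrAC => /(_ isT).
Qed.

Lemma disk_subP c c' r r' : 0 < r ->
  (disk c r `<=` disk c' r') -> normc (c - c') + r <= r'.
Proof.
move=> r0 sub; apply/ler_addgt0Pl => e e0.
(* The farthest point is on the boundary, outside the open disk; a slightly smaller radius [t] is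
   tested instead. *)
have [t [t0 tr tre]] : exists t, [/\ 0 <= t, t < r & r < t + e].
  by case: (leP r (e / 2)) => h; [exists 0|exists (r - e / 2)]; split; lra.
have [d dt dE] := exists_dir (c - c') t0.
have := sub (c + d); rewrite /disk /= (_ : c + d - c = d); last by ring.
by rewrite dt (_ : c + d - c' = c - c' + d) ?dE => [/(_ tr)|]; [lra|ring].
Qed.

Lemma cdisk_inj c c' r r' : 0 < r -> 0 < r' ->
  cdisk c r = cdisk c' r' -> c = c' /\ r = r'.
Proof.
move=> r0 r'0 e.
have h1 : normc (c - c') + r <= r' by apply: cdisk_subP; rewrite ?e // ltW.
have h2 : normc (c' - c) + r' <= r by apply: cdisk_subP; rewrite ?e // ltW.
have := normc_ge0 (c - c'); rewrite normcBC in h2 => h3.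
have /eqP : normc (c - c') = 0 by lra.
by rewrite normc_eq0 subr_eq0 => /eqP; split=> //; lra.
Qed.

Lemma disk_inj c c' r r' : 0 < r -> 0 < r' ->
  disk c r = disk c' r' -> c = c' /\ r = r'.
Proof.
move=> r0 r'0 e.
have h1 : normc (c - c') + r <= r' by apply: disk_subP; rewrite ?e.
have h2 : normc (c' - c) + r' <= r by apply: disk_subP; rewrite ?e.
have := normc_ge0 (c - c'); rewrite normcBC in h2 => h3.
have /eqP : normc (c - c') = 0 by lra.
by rewrite normc_eq0 subr_eq0 => /eqP; split=> //; lra.
Qed.

Lemma cdisk_in_unit c r : 0 < r -> cdisk c r `<=` disk 0 1 -> normc c + r < 1.
Proof.
move=> r0 sub; have [e er <-] := exists_dir c (ltW r0).
have := sub (c + e); rewrite /cdisk /disk /= subr0.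
by rewrite (_ : c + e - c = e) ?er ?lexx => [/(_ isT)|] //; ring.
Qed.

End Modulus.

(** * Holes and uniformizing pairs *)

Section Hole.
Variable R : realType.
Implicit Types (a c z w : R[i]) (r s t : R).

(* [Phi a] maps D(pcenter a s, pradius a s) onto D(0, s). *)
Definition pcenter a s : R[i] :=
  a * ((1 - s ^+ 2) / (1 - normc a ^+ 2 * s ^+ 2))%:C.

Definition pradius a s : R :=
  s * (1 - normc a ^+ 2) / (1 - normc a ^+ 2 * s ^+ 2).

Lemma pden_gt0 a s : normc a < 1 -> 0 < s < 1 ->
  0 < 1 - normc a ^+ 2 * s ^+ 2.
Proof.
move=> a1 /andP[s0 s1]; have a0 := normc_ge0 a.
rewrite -exprMn subr_gt0 expr_lt1 ?mulr_ge0 ?(ltW s0) //.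
by apply: mulr_ilt1 => //; exact: ltW.
Qed.

Lemma pradius_gt0 a s : normc a < 1 -> 0 < s < 1 -> 0 < pradius a s.
Proof.
move=> a1 sP; have k0 := pden_gt0 a1 sP; case/andP: sP => s0 _.
by rewrite /pradius divr_gt0 // mulr_gt0 // subr_gt0 expr_lt1 ?normc_ge0.
Qed.

(** Circle of Apollonius: the left side is a quadratic polynomial in [z] with leading coefficient
    [1 - |a|^2 s^2], and the right side completes the square. *)
Lemma hole_identity a s z : normc a < 1 -> 0 < s < 1 ->
  normc (z - a) ^+ 2 - s ^+ 2 * normc (1 - a^* * z) ^+ 2 =
  (1 - normc a ^+ 2 * s ^+ 2) *
  (normc (z - pcenter a s) ^+ 2 - pradius a s ^+ 2).
Proof.
move=> a1 sP; have := pden_gt0 a1 sP; rewrite /pradius /pcenter !sqr_normcE.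
case: a a1 => a b _; case: z => x y /= k0; simpc => /=; field.
exact: lt0r_neq0.
Qed.

Lemma hole_le a s z : normc a < 1 -> 0 < s < 1 ->
  (normc (z - a) <= s * normc (1 - a^* * z)) =
  (normc (z - pcenter a s) <= pradius a s).
Proof.
move=> a1 sP; have := hole_identity z a1 sP.
have k0 := pden_gt0 a1 sP; have r0 := pradius_gt0 a1 sP.
case/andP: sP => s0 _.
rewrite !normc_le_sqr ?(ltW r0) ?mulr_ge0 ?normc_ge0 ?(ltW s0) // => e.
by rewrite -subr_le0 exprMn e pmulr_rle0 // subr_le0.
Qed.

Lemma hole_lt a s z : normc a < 1 -> 0 < s < 1 ->
  (normc (z - a) < s * normc (1 - a^* * z)) =
  (normc (z - pcenter a s) < pradius a s).
Proof.
move=> a1 sP; have := hole_identity z a1 sP.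
have k0 := pden_gt0 a1 sP; have r0 := pradius_gt0 a1 sP.
case/andP: sP => s0 _.
rewrite !normc_lt_sqr ?(ltW r0) ?mulr_ge0 ?normc_ge0 ?(ltW s0) // => e.
by rewrite -subr_lt0 exprMn e pmulr_rlt0 // subr_lt0.
Qed.

Lemma normc_Phi a z : normc (Phi a z) = normc (z - a) / normc (1 - a^* * z).
Proof. by rewrite /Phi !normcM normcV normc_unimod mul1r. Qed.

Lemma pcenter_pradius_lt1 a s : normc a < 1 -> 0 < s < 1 ->
  normc (pcenter a s) + pradius a s < 1.
Proof.
move=> a1 sP; have k0 := pden_gt0 a1 sP; have a0 := normc_ge0 a.
case/andP: (sP) => s0 s1.
rewrite /pcenter normcM normc_realp; last first.
  by rewrite divr_ge0 ?(ltW k0) // subr_ge0 exprn_ile1 // ltW.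
rewrite /pradius mulrA -mulrDl ltr_pdivrMr // mul1r -subr_gt0.
rewrite (_ : _ - _ = (1 - normc a) * (1 - s) * (1 - normc a * s)); last by ring.
by rewrite !mulr_gt0 ?subr_gt0 // mulr_ilt1 // ltW.
Qed.

Lemma Phi_image_disk a s : normc a < 1 -> 0 < s < 1 ->
  Phi a @` disk (pcenter a s) (pradius a s) = disk 0 s.
Proof.
move=> a1 sP; have a0 := normc_ge0 a; case/andP: (sP) => s0 s1.
apply/seteqP; split=> [_ [z zc <-]|w]; rewrite /disk /= subr0.
  have z1 : normc z < 1.
    have := pcenter_pradius_lt1 a1 sP; have := normcB_ge z (pcenter a s).
    by move: zc; rewrite /disk /=; lra.
  have nz : 0 < normc (1 - a^* * z).
    by rewrite normc_gt0 one_sub_neq0 // normc_conj mulr_ilt1 ?normc_ge0.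
  by rewrite normc_Phi ltr_pdivrMr // hole_lt.
move=> ws; have nw : 1 + a^* * (w / unimod a) != 0.
  rewrite -[X in 1 + X]opprK -mulrN one_sub_neq0 // normc_conj normcN normcM.
  rewrite normcV normc_unimod invr1 mulr1 mulr_ilt1 ?normc_ge0 //.
  exact: lt_trans s1.
have da : disk 0 1 a by rewrite /disk /= subr0.
have aa := disk_conj_neq1 da.
have e1 : 1 - a^* * Phi_inv a w = (1 - a^* * a) / (1 + a^* * (w / unimod a)).
  rewrite /Phi_inv; move: (w / unimod a) (a^*)%C nw aa => v b nw aa; field.
  by [].
have nz : 1 - a^* * Phi_inv a w != 0 by rewrite e1 mulf_neq0 ?invr_eq0.
exists (Phi_inv a w); last exact: Phi_invK.
rewrite /disk /= -hole_lt // -ltr_pdivrMr ?normc_gt0 //.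
by rewrite -normc_Phi Phi_invK.
Qed.

(** The points [a] and [1 / conj a], symmetric in the unit circle, must also be symmetric in the
    circle of center [c] and radius [r]. For [a = k c] this is the equation
    [g^2 k^2 - B k + 1 = 0]. *)
Lemma exists_pair c r : 0 < r -> normc c + r < 1 ->
  exists a s, [/\ normc a < 1, 0 < s < 1, pcenter a s = c & pradius a s = r].
Proof.
move=> r0 cr; set g := normc c; have g0 : 0 <= g := normc_ge0 c.
pose B := 1 + g ^+ 2 - r ^+ 2.
have B2g : 2 * g < B.
  rewrite /B -subr_gt0 (_ : _ - _ = (1 - g - r) * (1 - g + r)); last by ring.
  by rewrite mulr_gt0 // /g; lra.
have B0 : 0 < B by lra.
have d0 : 0 <= B ^+ 2 - 4 * g ^+ 2.
  rewrite (_ : _ - _ = (B - 2 * g) * (B + 2 * g)); last by ring.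
  by rewrite mulr_ge0 //; lra.
pose q := Num.sqrt (B ^+ 2 - 4 * g ^+ 2).
have q0 : 0 <= q := sqrtr_ge0 _.
have q2 : q ^+ 2 = B ^+ 2 - 4 * g ^+ 2 by rewrite sqr_sqrtr.
have Bq : 0 < B + q by lra.
(* The smaller root, which puts [a] inside the unit disk, in a form that covers [g = 0] as well. *)
pose k := 2 / (B + q); have k0 : 0 < k by rewrite divr_gt0.
have kE : 1 + g ^+ 2 * k ^+ 2 = k * B.
  apply/eqP; rewrite -subr_eq0 /k.
  rewrite (_ : _ - _ = (q ^+ 2 - (B ^+ 2 - 4 * g ^+ 2)) / (B + q) ^+ 2).
    by rewrite q2 subrr mul0r.
  by field; exact: lt0r_neq0.
have gk : g * k < 1 by rewrite /k mulrA ltr_pdivrMr //; lra.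
have gk2 : g ^+ 2 * k <= g.
  by rewrite expr2 -mulrA ler_piMr // ltW.
have h0 : 0 < 1 - g ^+ 2 * k by rewrite -/g in cr; lra.
(* The constant value of [|z - a| / |1 - conj(a) z|] on the circle, namely [r / (1 - g |a|)]. *)
pose s := r / (1 - g ^+ 2 * k).
have s01 : 0 < s < 1.
  by rewrite divr_gt0 //= ltr_pdivrMr // mul1r; rewrite -/g in cr; lra.
have na : normc (c * k%:C) = g * k by rewrite normcM normc_realp // ltW.
have a1 : normc (c * k%:C) < 1 by rewrite na.
have k1 := pden_gt0 a1 s01; rewrite na in k1.
have hn0 := lt0r_neq0 h0.
have rE : r ^+ 2 = 1 + g ^+ 2 - (1 + g ^+ 2 * k ^+ 2) / k.
  by rewrite kE mulrAC divff ?lt0r_neq0 // mul1r /B; ring.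
have kn0 := lt0r_neq0 k0.
have denE : 1 - (g * k) ^+ 2 * s ^+ 2 = (1 - g ^+ 2 * k ^+ 2) / (1 - g ^+ 2 * k).
  by rewrite /s expr_div_n rE; field; rewrite hn0.
have numE : 1 - s ^+ 2 = (1 - g ^+ 2 * k ^+ 2) / (1 - g ^+ 2 * k) / k.
  by rewrite /s expr_div_n rE; field; rewrite kn0 hn0.
rewrite denE in k1.
have n0 : 1 - g ^+ 2 * k ^+ 2 != 0.
  by apply: contraTneq k1 => ->; rewrite mul0r ltxx.
exists (c * k%:C), s; split => //.
  rewrite /pcenter na denE numE -mulrA -rmorphM /=.
  by rewrite (mulrAC _ k^-1) divff ?lt0r_neq0 // mul1r divff // rmorph1 mulr1.
rewrite /pradius na denE /s exprMn; field.
by rewrite hn0 exprMn.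
Qed.

End Hole.

(** * Complex derivatives through increments *)

Section Differential.
Variable R : realType.
Implicit Types (f g : R[i] -> R[i]) (z A B : R[i]).

(** Real tolerances and no quotient: the rules below need neither filters on [R[i]] nor a separate
    case [h = 0]. *)
Definition cdiff f z A := forall e : R, 0 < e ->
  exists2 d : R, 0 < d & forall h, normc h < d ->
    normc (f (z + h) - f z - A * h) <= e * normc h.

(** A tolerance [e / (n + 1)] absorbs a factor [n] that may be zero. *)
Lemma ler_divMl_add1 (e n : R) : 0 <= e -> 0 <= n -> e / (n + 1) * n <= e.
Proof.
move=> e0 n0; rewrite mulrAC ler_pdivrMr; last by rewrite ltr_wpDl.
by rewrite ler_wpM2l // lerDl.
Qed.

Lemma cdiff_quotient f z A : cdiff f z A ->
  (fun h : R[i]^o => h^-1 *: ((f : R[i]^o -> R[i]^o) (h *: (1 : R[i]^o) + z) - f z))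
    @ 0^' --> (A : R[i]^o).
Proof.
move=> fA; apply/cvgrPdist_le => /= e; rewrite ltcE /= => /andP[/eqP e0 ep].
have eE : e = (Re e)%:C by case: (e) e0 => x y /= ->.
have [d d0 H] := fA _ ep; near=> h.
have h0 : h != 0 by near: h; exact: nbhs_dnbhs_neq.
have hd : normc h < d.
  rewrite -ltcR -[(normc h)%:C]/(`|h|); near: h; apply: dnbhs0_lt.
  by rewrite ltcE /= eqxx.
rewrite eE lecR -[normc _]/(normc _) normcBC.
have -> : h^-1 *: (f (h *: (1 : R[i]^o) + z) - f z) - A =
    (f (z + h) - f z - A * h) / h.
  rewrite -[h *: 1]/(h * 1) mulr1 [h + z]addrC -[_ *: _]/(_ * _).
  by rewrite [h^-1 * _]mulrC [RHS]mulrBl mulfK.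
rewrite normcM normcV ler_pdivrMr ?normc_gt0 //; exact: H.
Unshelve. all: by end_near. Qed.

Lemma cdiff_derivable f z A : cdiff f z A -> cderivable f z.
Proof. by move=> /cdiff_quotient h; apply: (cvgP (A : R[i]^o)); exact: h. Qed.

Lemma cdiff_derive f z A : cdiff f z A -> cderive f z = A.
Proof. 
move=> /cdiff_quotient h; rewrite /cderive /derive.
exact: (cvg_lim (@norm_hausdorff R[i] R[i]^o) h). Qed.

Lemma cderivable_cdiff f z : cderivable f z -> cdiff f z (cderive f z).
Proof.
move=> /cvgrPdist_le /= H e e0; have := H e%:C.
rewrite ltcR => /(_ e0) /nbhs_ballP[d d0 Hd].
have {}d0 : 0 < d := d0.
have dE : d = (Re d)%:C.
  by move: d0; rewrite ltcE /= => /andP[/eqP]; case: (d) => x y /= ->.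
exists (Re d) => [|h hd]; first by move: d0; rewrite ltcE => /andP[].
have [->|h0] := eqVneq h 0.
  by rewrite addr0 subrr mulr0 subr0 normc0 mulr0.
have := Hd h; rewrite /ball /= sub0r normrN => /(_ _ h0).
rewrite dE -[`|h|]/((normc h)%:C) ltcR => /(_ hd).
rewrite -[`|_|]/((normc _)%:C) lecR normcBC.
have -> : h^-1 *: (f (h *: (1 : R[i]^o) + z) - f z) - cderive f z =
    (f (z + h) - f z - cderive f z * h) / h.
  rewrite -[h *: 1]/(h * 1) mulr1 [h + z]addrC -[_ *: _]/(_ * _).
  by rewrite [h^-1 * _]mulrC [RHS]mulrBl mulfK.
by rewrite normcM normcV ler_pdivrMr ?normc_gt0.
Qed.

Lemma cdiff_comp f g z A B : cdiff g z A -> cdiff f (g z) B ->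
  cdiff (f \o g) z (B * A).
Proof.
move=> gA fB e e0; have A0 := normc_ge0 A; have B0 := normc_ge0 B.
have [|d1 d10 H1] := fB (e / 2 / (normc A + 1)); first by rewrite !divr_gt0 //; lra.
have b0 : 0 < e / 2 / (normc B + 1) by rewrite !divr_gt0 //; lra.
(* The bound by 1 gives [|k| <= (|A| + 1) |h|] for the increment [k] of [g]; the other bound takes
   care of the error multiplied by [B]. *)
have m0 : 0 < Num.min 1 (e / 2 / (normc B + 1)) by rewrite lt_min ltr01.
have [d2 d20 H2] := gA _ m0.
exists (Num.min d2 (d1 / (normc A + 1))).
  by rewrite lt_min d20 divr_gt0 //; lra.
move=> h; rewrite lt_min ltr_pdivlMr; last by lra.
move=> /andP[hd2 hd1]; have h0 := normc_ge0 h.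
have := H2 _ hd2; set k := g (z + h) - g z => Hk.
have Hk1 : normc (k - A * h) <= normc h.
  by apply: le_trans Hk _; rewrite ler_piMl // ge_min lexx.
have Hk2 : normc (k - A * h) <= e / 2 / (normc B + 1) * normc h.
  by apply: le_trans Hk _; rewrite ler_wpM2r // ge_min lexx orbT.
have kh : normc k <= (normc A + 1) * normc h.
  have := le_normcD (k - A * h) (A * h); rewrite subrK normcM; lra.
have := H1 k; rewrite (_ : g z + k = g (z + h)); last by rewrite /k; ring.
rewrite [(_ + 1) * _]mulrC in kh.
move=> /(_ (le_lt_trans kh hd1)) Hf /=.
rewrite (_ : _ - _ - _ = f (g (z + h)) - f (g z) - B * k + B * (k - A * h));
  last by ring.
apply: le_trans (le_normcD _ _) _; rewrite normcM.
have e1 : normc (f (g (z + h)) - f (g z) - B * k) <= e / 2 * normc h.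
  apply: le_trans Hf _; rewrite -mulrA ler_wpM2l ?divr_ge0 ?(ltW e0) //.
  rewrite mulrC ler_pdivrMr //; lra.
have e2 : normc B * normc (k - A * h) <= e / 2 * normc h.
  apply: le_trans (ler_wpM2l B0 Hk2) _; rewrite mulrA ler_wpM2r //.
  rewrite mulrCA ler_piMr ?divr_ge0 ?(ltW e0) //.
  rewrite ler_pdivrMr; lra.
lra.
Qed.

Lemma cdiff_bound f z A : cdiff f z A ->
  exists2 d : R, 0 < d & forall h, normc h < d ->
    normc (f (z + h) - f z) <= (normc A + 1) * normc h.
Proof.
move=> /(_ 1 ltr01)[d d0 H]; exists d => // h /H.
have := le_normcD (f (z + h) - f z - A * h) (A * h).
rewrite subrK normcM; lra.
Qed.

Lemma cdiffM f g z A B : cdiff f z A -> cdiff g z B ->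
  cdiff (fun w => f w * g w) z (A * g z + f z * B).
Proof.
move=> fA gB e e0; have [d0 d00 H0] := cdiff_bound fA.
have nf := normc_ge0 (f z); have ng := normc_ge0 (g z).
have nA := normc_ge0 A; have nB := normc_ge0 B.
have [d1 d10 H1] : exists2 d : R, 0 < d & forall h, normc h < d ->
    normc (f (z + h) - f z - A * h) <= e / 3 / (normc (g z) + 1) * normc h.
  by apply: fA; rewrite !divr_gt0 //; lra.
have [d2 d20 H2] : exists2 d : R, 0 < d & forall h, normc h < d ->
    normc (g (z + h) - g z - B * h) <= e / 3 / (normc (f z) + 1) * normc h.
  by apply: gB; rewrite !divr_gt0 //; lra.
have [d3 d30 H3] := cdiff_bound gB.
pose K := (normc A + 1) * (normc B + 1).
have K0 : 0 < K by rewrite mulr_gt0 //; lra.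
exists (Num.min (Num.min d0 d1) (Num.min d2 (Num.min d3 (e / 3 / K)))).
  by rewrite !lt_min d00 d10 d20 d30 !divr_gt0.
move=> h; rewrite !lt_min => /andP[/andP[/H0 h0 /H1 h1] /and3P[/H2 h2 /H3 h3 hK]].
have nh := normc_ge0 h.
rewrite (_ : _ - _ - _ = (f (z + h) - f z - A * h) * g z +
  (f z * (g (z + h) - g z - B * h) + (f (z + h) - f z) * (g (z + h) - g z)));
  last by ring.
have e1 : normc ((f (z + h) - f z - A * h) * g z) <= e / 3 * normc h.
  rewrite normcM; apply: le_trans (ler_wpM2r ng h1) _.
  have := ler_divMl_add1 (divr_ge0 (ltW e0) (ler0n _ 3)) ng.
  by move=> /(ler_wpM2r nh); rewrite mulrAC.
have e2 : normc (f z * (g (z + h) - g z - B * h)) <= e / 3 * normc h.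
  rewrite normcM; apply: le_trans (ler_wpM2l nf h2) _.
  have := ler_divMl_add1 (divr_ge0 (ltW e0) (ler0n _ 3)) nf.
  by move=> /(ler_wpM2r nh); rewrite mulrA [normc (f z) * _]mulrC.
have e3 : normc ((f (z + h) - f z) * (g (z + h) - g z)) <= e / 3 * normc h.
  rewrite normcM; apply: le_trans (ler_pM (normc_ge0 _) (normc_ge0 _) h0 h3) _.
  rewrite mulrACA -/K mulrA ler_wpM2r //.
  by rewrite mulrC -ler_pdivlMr // ltW.
have := le_normcD ((f (z + h) - f z - A * h) * g z)
  (f z * (g (z + h) - g z - B * h) + (f (z + h) - f z) * (g (z + h) - g z)).
have := le_normcD (f z * (g (z + h) - g z - B * h))
  ((f (z + h) - f z) * (g (z + h) - g z)).
lra.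
Qed.

End Differential.

(** * Products of two reflections *)

Section Moebius.
Variable R : realType.
Implicit Types (a c z w : R[i]) (r s t : R).

(* The reflection in the unit circle followed by the one in |w - c| = r. *)
Definition moeb c r z : R[i] := c + (r ^+ 2)%:C * z / (1 - c^* * z).

Lemma moeb_sub c r z w : 1 - c^* * z != 0 -> 1 - c^* * w != 0 ->
  moeb c r z - moeb c r w =
  (z - w) * (r%:C / (1 - c^* * z)) * (r%:C / (1 - c^* * w)).
Proof.
rewrite /moeb rmorphXn /=; move: (c^*)%C (r%:C) => b q h1 h2; field.
by rewrite h1 h2.
Qed.

Lemma normc_pcenter_le a s : normc a < 1 -> 0 < s < 1 ->
  normc (pcenter a s) <= normc a.
Proof.
move=> a1 sP; have k0 := pden_gt0 a1 sP; have a0 := normc_ge0 a.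
have a21 : normc a ^+ 2 <= 1 by rewrite exprn_ile1 // ltW.
case/andP: sP => s0 s1; rewrite /pcenter normcM normc_realp.
  rewrite ler_piMr // ler_pdivrMr // mul1r lerB // ler_piMl ?sqr_ge0 //.
by rewrite divr_ge0 ?(ltW k0) // subr_ge0 exprn_ile1 // ltW.
Qed.

(** Both sides fix [a] and its mirror image in the unit circle, with multiplier [s ^+ 2] at [a]. The
    proof is a computation, whose substance lies in the nonvanishing denominators. *)
Lemma Phi_inv_scaleE a s z : normc a < 1 -> 0 < s < 1 -> normc a * normc z < 1 ->
  Phi_inv a ((s ^+ 2)%:C * Phi a z) = moeb (pcenter a s) (pradius a s) z.
Proof.
move=> a1 sP az; have a0 := normc_ge0 a; have z0 := normc_ge0 z.
have k0 := pden_gt0 a1 sP; have u0 := unimod_neq0 a.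
have n1 : 1 - a^* * z != 0 by rewrite one_sub_neq0 // normc_conj.
have n2 : 1 - (pcenter a s)^* * z != 0.
  rewrite one_sub_neq0 // normc_conj; apply: le_lt_trans az.
  by rewrite ler_wpM2r // normc_pcenter_le.
have kC : 1 - a * a^* * (s ^+ 2)%:C != 0.
  rewrite mul_conj -rmorphM -[1](rmorph1 (real_complex R)) -rmorphB.
  by rewrite fmorph_eq0 lt0r_neq0.
have cE : pcenter a s = a * (1 - (s ^+ 2)%:C) / (1 - a * a^* * (s ^+ 2)%:C).
  rewrite /pcenter mul_conj -mulrA; congr (a * _).
  by rewrite fmorph_div !rmorphB rmorph1 (rmorphM (real_complex R) (normc a ^+ 2)).
have cJ : (pcenter a s)^* =
    a^* * (1 - (s ^+ 2)%:C) / (1 - a * a^* * (s ^+ 2)%:C).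
  rewrite mul_conj /pcenter conjcM conjcR.
  rewrite -mulrA; congr (_ * _).
  by rewrite fmorph_div !rmorphB rmorph1 (rmorphM (real_complex R) (normc a ^+ 2)).
have rE : (pradius a s ^+ 2)%:C = (s ^+ 2)%:C * (1 - a * a^*) ^+ 2 /
    (1 - a * a^* * (s ^+ 2)%:C) ^+ 2.
  rewrite /pradius mul_conj expr_div_n exprMn fmorph_div.
  rewrite (rmorphM (real_complex R) (s ^+ 2)) !(rmorphXn (real_complex R) 2 (1 - _)).
  by rewrite !rmorphB rmorph1 (rmorphM (real_complex R) (normc a ^+ 2)).
have n3 : 1 - a * a^* * (s ^+ 2)%:C - a^* * (1 - (s ^+ 2)%:C) * z != 0.
  move: n2; rewrite cJ; apply: contraNneq => e.
  have -> : 1 - a^* * (1 - (s ^+ 2)%:C) / (1 - a * a^* * (s ^+ 2)%:C) * z =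
      (1 - a * a^* * (s ^+ 2)%:C - a^* * (1 - (s ^+ 2)%:C) * z) /
      (1 - a * a^* * (s ^+ 2)%:C).
    by move: (a^*) ((s ^+ 2)%:C) kC => b S kC; field.
  by rewrite e mul0r.
rewrite /Phi_inv /Phi /moeb rE cJ cE.
move: (unimod a) (a^*)%C ((s ^+ 2)%:C) u0 n1 kC n3 => u b S u0 n1 kC n3.
by field; rewrite u0 n1 kC n3.
Qed.

Lemma moeb_le_real c r t z : normc z <= t -> normc c * t < 1 ->
  normc (moeb c r z) <= normc c + r ^+ 2 * t / (1 - normc c * t).
Proof.
move=> zt ct1; have dz : 0 < 1 - normc c * t by rewrite subr_gt0.
have cz1 : normc c * normc z <= normc c * t by rewrite ler_wpM2l ?normc_ge0.
apply: le_trans (le_normcD _ _) _; rewrite lerD2l.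
rewrite 2!normcM normcV normc_realp ?sqr_ge0 //.
have dz' : 1 - normc c * t <= normc (1 - c^* * z).
  by have := one_sub_normc_ge c^* z; rewrite normc_conj; lra.
apply: ler_pM.
- by rewrite mulr_ge0 ?sqr_ge0 ?normc_ge0.
- by rewrite invr_ge0 normc_ge0.
- by rewrite ler_wpM2l ?sqr_ge0.
by rewrite lef_pV2 ?posrE // (lt_le_trans dz).
Qed.

(** The worst [z] is [t] times the direction of [a]. There the map is a real Moebius map with fixed
    points [|a|] and [1 / |a|], so the difference to [t] has the factors [t - |a|] and
    [1 - |a| t]. *)
Lemma moeb_le a s t z : normc a < 1 -> 0 < s < 1 ->
  normc z <= t -> normc a <= t -> normc a * t < 1 ->
  normc (moeb (pcenter a s) (pradius a s) z) <= t.
Proof.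
move=> a1 sP zt lat at1; have a0 := normc_ge0 a; have z0 := normc_ge0 z.
have t0 : 0 <= t := le_trans a0 lat.
have k0 := pden_gt0 a1 sP; have ca := normc_pcenter_le a1 sP.
have r0 := pradius_gt0 a1 sP.
have c0 := normc_ge0 (pcenter a s).
have ct1 : normc (pcenter a s) * t < 1.
  by apply: le_lt_trans at1; rewrite ler_wpM2r.
have cz1 : normc (pcenter a s) * normc z <= normc (pcenter a s) * t.
  by rewrite ler_wpM2l.
have dz : 0 < 1 - normc (pcenter a s) * t by rewrite subr_gt0.
apply: le_trans (moeb_le_real _ zt ct1) _.
case/andP: sP => s0 s1.
have S1 : s ^+ 2 < 1 by rewrite expr_lt1 // ltW.
have cE : normc (pcenter a s) =
    normc a * ((1 - s ^+ 2) / (1 - normc a ^+ 2 * s ^+ 2)).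
  by rewrite /pcenter normcM normc_realp // divr_ge0 // ltW // subr_gt0.
have rE : pradius a s ^+ 2 = s ^+ 2 *
  ((1 - normc a ^+ 2) / (1 - normc a ^+ 2 * s ^+ 2)) ^+ 2.
  by rewrite /pradius -mulrA exprMn.
move: dz; rewrite cE rE => {cE rE} dz.
move: (normc a) (s ^+ 2) a0 a1 lat at1 k0 S1 dz (sqr_ge0 s)
  => x S x0 x1 xt xt1 k0 S1 dz S0.
have kn := lt0r_neq0 k0; have dn := lt0r_neq0 dz.
have m0 : 0 < 1 - x ^+ 2 * S - x * (1 - S) * t.
  have := mulr_gt0 k0 dz; congr (0 < _); field; exact: kn.
have mn := lt0r_neq0 m0.
rewrite -subr_ge0.
have -> : t - (x * ((1 - S) / (1 - x ^+ 2 * S)) +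
   S * ((1 - x ^+ 2) / (1 - x ^+ 2 * S)) ^+ 2 * t /
   (1 - x * ((1 - S) / (1 - x ^+ 2 * S)) * t)) =
   (1 - S) * (t - x) * (1 - x * t) / (1 - x ^+ 2 * S - x * (1 - S) * t).
  by field; rewrite kn mn.
by rewrite divr_ge0 ?(ltW m0) // !mulr_ge0 // subr_ge0 // ltW.
Qed.

End Moebius.

(** * Words in the maps T_j *)

Section Words.
Variables (R : realType) (D : cmcd R).
Implicit Types (j : 'I_(holes D)) (w : seq 'I_(holes D)) (z : R[i]).

Lemma holes_in_unit j : normc (center D j) + radius D j < 1.
Proof. exact: cdisk_in_unit (radius_gt0 j) (@hole_sub _ _ j). Qed.

Lemma Phi_inj_unit (a : R[i]) (A B : set R[i]) : normc a < 1 ->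
  A `<=` disk 0 1 -> B `<=` disk 0 1 -> Phi a @` A = Phi a @` B -> A `<=` B.
Proof.
move=> a1 A1 B1 e z Az; have : (Phi a @` B) (Phi a z) by rewrite -e; exists z.
have da : disk 0 1 a by rewrite /disk /= subr0.
have nz y : disk 0 1 y -> 1 - a^* * y != 0.
  rewrite /disk /= subr0 => y1.
  by rewrite one_sub_neq0 // normc_conj mulr_ilt1 ?normc_ge0.
move=> [y By /(congr1 (Phi_inv a))].
by rewrite !PhiK //; [move=> <-|exact/nz/A1|exact/nz/B1].
Qed.

Lemma disk_sub_unit (c : R[i]) (r : R) : normc c + r < 1 -> disk c r `<=` disk 0 1.
Proof.
move=> cr z; rewrite /disk /= subr0 => zc.
by have := normcB_ge z c; lra.
Qed.

(** The hole and the disk given by [pcenter] and [pradius] have the same image under [Phi], which is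
    injective on the unit disk. *)
Lemma uniformizing_pcenter j p : uniformizing j p ->
  [/\ normc p.1 < 1, 0 < p.2 < 1, center D j = pcenter p.1 p.2 &
      radius D j = pradius p.1 p.2].
Proof.
case: p => a s [/= a1 s0 s1 im].
have {}a1 : normc a < 1 by move: a1; rewrite /disk /= subr0.
have sP : 0 < s < 1 by rewrite s0.
have im' := Phi_image_disk a1 sP; rewrite -im in im'.
have h1 := disk_sub_unit (holes_in_unit j).
have h2 := disk_sub_unit (pcenter_pradius_lt1 a1 sP).
have [-> ->] : center D j = pcenter a s /\ radius D j = pradius a s.
  apply: disk_inj; rewrite ?radius_gt0 ?pradius_gt0 //.
  by apply/seteqP; split; apply: (Phi_inj_unit a1).
by split.
Qed.

Lemma a_sigmaP j :
  [/\ normc (a_ j) < 1, 0 < sigma_ j < 1, center D j = pcenter (a_ j) (sigma_ j) &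
      radius D j = pradius (a_ j) (sigma_ j)].
Proof.
apply: uniformizing_pcenter.
have [a [s [a1 sP ac sr]]] := exists_pair (radius_gt0 j) (holes_in_unit j).
rewrite /a_sigma; apply: (@xgetPex _ (0, 0) [set p | uniformizing j p]).
exists (a, s); case/andP: (sP) => s0 s1; split => //=.
  by rewrite /disk /= subr0.
by rewrite -ac -sr Phi_image_disk.
Qed.

Lemma normc_a_lt1 j : normc (a_ j) < 1. Proof. by case: (a_sigmaP j). Qed.

Lemma a_le_rho j : normc (a_ j) <= rho D.
Proof. exact: (le_bigmax_cond 0 (fun j => normc (a_ j))). Qed.

Lemma rho_ge0 : 0 <= rho D. Proof. exact: bigmax_ge_id. Qed.

Lemma rho_lt1 : rho D < 1.
Proof. by apply: bigmax_lt => // j _; exact: normc_a_lt1. Qed.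

Lemma center_le_rho j : normc (center D j) <= rho D.
Proof.
have [a1 sP -> _] := a_sigmaP j.
exact: le_trans (normc_pcenter_le a1 sP) (a_le_rho j).
Qed.

(** A single inequality that also covers [rho D = 0]; the big disk is used in this form below. *)
Lemma bigdiskE z : bigdisk D z <-> rho D * normc z < 1.
Proof.
rewrite /bigdisk; case: eqVneq => [->|r0]; first by rewrite mul0r ltr01.
have rp : 0 < rho D by rewrite lt_def r0 rho_ge0.
by rewrite /disk /= subr0 -[_^-1]mul1r ltr_pdivlMr // mulrC.
Qed.

Lemma unit_rho z : normc z <= 1 -> rho D * normc z < 1.
Proof.
move=> z1; apply: le_lt_trans rho_lt1.
by rewrite ler_piMr // rho_ge0.
Qed.

Lemma denom_neq0 j z : rho D * normc z < 1 -> 1 - (center D j)^* * z != 0.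
Proof.
move=> z1; rewrite one_sub_neq0 // normc_conj; apply: le_lt_trans z1.
by rewrite ler_wpM2r ?normc_ge0 // center_le_rho.
Qed.

Lemma T_E j z : rho D * normc z < 1 -> T_ j z = moeb (center D j) (radius D j) z.
Proof.
move=> z1; have [a1 sP -> ->] := a_sigmaP j; apply: Phi_inv_scaleE => //.
by apply: le_lt_trans z1; rewrite ler_wpM2r ?normc_ge0 // a_le_rho.
Qed.

Lemma T_le j z t : normc z <= t -> rho D <= t -> rho D * t < 1 ->
  normc (T_ j z) <= t.
Proof.
move=> zt rt rt1; have t0 : 0 <= t := le_trans rho_ge0 rt.
rewrite T_E; last by apply: le_lt_trans rt1; rewrite ler_wpM2l ?rho_ge0.
have [a1 sP -> ->] := a_sigmaP j; apply: moeb_le => //.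
  exact: le_trans (a_le_rho j) rt.
by apply: le_lt_trans rt1; rewrite ler_wpM2r // a_le_rho.
Qed.

Lemma T_bigdisk j z : rho D * normc z < 1 -> rho D * normc (T_ j z) < 1.
Proof.
move=> z1; have rr : rho D * rho D < 1.
  by rewrite mulr_ilt1 ?rho_ge0 ?rho_lt1.
(* Closed disks about 0 with radius at least [rho D] and inside the big disk are preserved; this is
   the smallest such radius that reaches [z]. *)
have mt : rho D * Num.max (normc z) (rho D) < 1.
  by case: (leP (normc z) (rho D)) => _.
apply: le_lt_trans mt; rewrite ler_wpM2l ?rho_ge0 //.
by apply: T_le; rewrite ?le_max ?lexx ?orbT //; case: (leP (normc z) (rho D)).
Qed.

Lemma Tword_bigdisk w z : rho D * normc z < 1 -> rho D * normc (Tword w z) < 1.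
Proof. by elim: w => //= j w IH /IH; exact: T_bigdisk. Qed.

(* The square root of the derivative of a word, chosen to be a cocycle. *)
Definition sqD j z : R[i] := (radius D j)%:C / (1 - (center D j)^* * z).

Fixpoint sqDword w z : R[i] :=
  if w is j :: w' then sqD j (Tword w' z) * sqDword w' z else 1.

Lemma T_sub j z z' : rho D * normc z < 1 -> rho D * normc z' < 1 ->
  T_ j z - T_ j z' = (z - z') * sqD j z * sqD j z'.
Proof. by move=> h h'; rewrite !T_E // moeb_sub // denom_neq0. Qed.

Lemma Tword_sub w z z' : rho D * normc z < 1 -> rho D * normc z' < 1 ->
  Tword w z - Tword w z' = (z - z') * sqDword w z * sqDword w z'.
Proof.
move=> h h'; elim: w => [|j w IH] /=; first by rewrite !mulr1.
by rewrite T_sub ?Tword_bigdisk // IH; ring.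
Qed.

Lemma Tword_cat w w' z : Tword (w ++ w') z = Tword w (Tword w' z).
Proof. by elim: w => //= j w ->. Qed.

Lemma sqDword_cat w w' z :
  sqDword (w ++ w') z = sqDword w (Tword w' z) * sqDword w' z.
Proof. by elim: w => [|j w IH] /=; rewrite ?mul1r // IH Tword_cat mulrA. Qed.

(* The pole A/B of a word lies outside the big disk: distortion bounds follow. *)
Lemma sqDword_affine w : exists A B : R[i], normc B <= rho D * normc A /\
  forall z, rho D * normc z < 1 -> sqDword w z * (A - B * z) = 1.
Proof.
suff [A [B H]] : exists A B : R[i],
    forall z, rho D * normc z < 1 -> sqDword w z * (A - B * z) = 1.
  exists A, B; split => //; rewrite leNgt; apply/negP => BA.
  have B0 : B != 0.
    apply: contraTneq BA => ->; rewrite normc0 -leNgt.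
    by rewrite mulr_ge0 ?rho_ge0 ?normc_ge0.
  (* Otherwise the identity could be evaluated at the pole [A / B], where it reads 0 = 1. *)
  have AB : rho D * normc (A / B) < 1.
    by rewrite normcM normcV mulrA ltr_pdivrMr ?normc_gt0 // mul1r.
  by have := H _ AB; rewrite mulrCA divff // mulr1 subrr mulr0 => /eqP; rewrite eq_sym oner_eq0.
(* Induction on the letter applied first: composing [A - B z] with [T_ j] and multiplying by the
   denominator of [T_ j] gives an affine function again. *)
elim/last_ind: w => [|w j [A [B IH]]].
  by exists 1, 0 => z _ /=; rewrite mul0r subr0 mulr1.
have r0 : (radius D j)%:C != 0 :> R[i].
  by rewrite fmorph_eq0 lt0r_neq0 // radius_gt0.
set c := center D j; set r := (radius D j)%:C in r0 *.
exists ((A - B * c) / r), ((A * c^* + B * (r ^+ 2 - c^* * c)) / r) => z z1.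
have nz := denom_neq0 j z1; have := IH _ (T_bigdisk j z1).
rewrite -cats1 sqDword_cat /= mulr1 T_E // /moeb /sqD -/c -/r rmorphXn /= -/r.
move: (sqDword w _) nz; rewrite -/c => d nz e; rewrite -[RHS]e; field.
by rewrite r0 nz.
Qed.

(** From [|B| <= rho |A|] follows [|A - B z| >= |A| (1 - rho |z|)], where [1 / A] is the value at
    0. *)
Lemma sqDword_le w z : rho D * normc z < 1 ->
  normc (sqDword w z) * (1 - rho D * normc z) <= normc (sqDword w 0).
Proof.
move=> z1; have [A [B [BA H]]] := sqDword_affine w.
have := H 0; rewrite normc0 mulr0 ltr01 mulr0 subr0 => /(_ isT) /(congr1 (@normc R)).
have := H z z1 => /(congr1 (@normc R)); rewrite !normcM normc1 => e1 e0.
have A0 : 0 < normc A.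
  by rewrite normc_gt0; apply: contra_eq_neq e0 => ->; rewrite normc0 mulr0 eq_sym oner_neq0.
have zge : normc A * (1 - rho D * normc z) <= normc (A - B * z).
  have := normcB_ge A (B * z); rewrite normcM.
  have := ler_wpM2r (normc_ge0 z) BA; nra.
rewrite -(ler_pM2r A0) e0 -[X in _ <= X]e1 -mulrA ler_wpM2l ?normc_ge0 //.
by rewrite mulrC.
Qed.

(** The opposite distortion bound; the 2 comes from [|A - B z| <= |A| (1 + rho |z|)]. *)
Lemma sqDword_ge w z : normc z <= 1 -> normc (sqDword w 0) <= 2 * normc (sqDword w z).
Proof.
move=> z1; have [A [B [BA H]]] := sqDword_affine w.
have := H 0; rewrite normc0 mulr0 ltr01 mulr0 subr0 => /(_ isT) /(congr1 (@normc R)).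
have := H z (unit_rho z1) => /(congr1 (@normc R)); rewrite !normcM normc1 => e1 e0.
have A0 : 0 < normc A.
  by rewrite normc_gt0; apply: contra_eq_neq e0 => ->; rewrite normc0 mulr0 eq_sym oner_neq0.
have zle : normc (A - B * z) <= 2 * normc A.
  have := le_normcD A (- (B * z)); rewrite normcN normcM.
  have := ler_wpM2r (normc_ge0 z) BA; have := unit_rho z1; nra.
rewrite -(ler_pM2r A0) e0 -[X in X <= _]e1 (mulrC 2) -mulrA.
by rewrite ler_wpM2l ?normc_ge0.
Qed.

Lemma Tword_cdiff w z : rho D * normc z < 1 -> cdiff (Tword w) z (sqDword w z ^+ 2).
Proof.
move=> z1 e e0; have [A [B [_ H]]] := sqDword_affine w.
set q := 1 - rho D * normc z; have q0 : 0 < q by rewrite subr_gt0.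
have r0 := rho_ge0; have r1 := rho_lt1; have n0 := normc_ge0 (sqDword w 0).
pose M := normc (sqDword w 0) / (q / 2).
have M0 : 0 <= M by rewrite divr_ge0 // divr_ge0 // ltW.
pose K := normc (sqDword w z) ^+ 2 * normc B * M.
have K0 : 0 <= K.
  apply: mulr_ge0 M0; apply: mulr_ge0; [exact: sqr_ge0|exact: normc_ge0].
exists (Num.min (q / 2) (e / (K + 1))).
  by rewrite lt_min !divr_gt0 //; lra.
move=> h; rewrite lt_min => /andP[hq he]; have h0 := normc_ge0 h.
have zh : rho D * normc (z + h) <= 1 - q / 2.
  have := ler_wpM2l r0 (le_normcD z h); rewrite mulrDr /q.
  have : rho D * normc h <= q / 2 by apply: le_trans (ltW hq); rewrite ler_piMl // ltW.
  rewrite /q; lra.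
have zh1 : rho D * normc (z + h) < 1 by lra.
have Mle : normc (sqDword w (z + h)) <= M.
  have := sqDword_le w zh1; rewrite /M ler_pdivlMr ?divr_gt0 //.
  have := normc_ge0 (sqDword w (z + h)); nra.
rewrite Tword_sub // (_ : z + h - z = h); last by ring.
(* Since [1 / d] is affine, [d(z + h) - d(z) = B h d(z) d(z + h)]; the remainder is exactly
   quadratic in [h]. *)
have -> : h * sqDword w (z + h) * sqDword w z - sqDword w z ^+ 2 * h =
   (sqDword w z ^+ 2 * B * sqDword w (z + h)) * h * h.
  rewrite -[X in X * sqDword w z - _]mulr1 -{1}(H z z1).
  by rewrite -[X in _ - X]mulr1 -[X in _ - _ * X](H _ zh1); ring.
rewrite [normc (_ * h)]normcM ler_wpM2r // normcM.
apply: le_trans (_ : K * normc h <= _).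
  rewrite ler_wpM2r // 2!normcM expr2 normcM -expr2 /K ler_wpM2l //.
  by apply: mulr_ge0; [exact: sqr_ge0|exact: normc_ge0].
apply: le_trans (ler_divMl_add1 (ltW e0) K0).
by rewrite [leRHS]mulrC ler_wpM2l // ltW.
Qed.

Lemma Tword_cderive w z : rho D * normc z < 1 ->
  normc (cderive (Tword w) z) = normc (sqDword w z) ^+ 2.
Proof.
by move=> z1; rewrite (cdiff_derive (Tword_cdiff w z1)) expr2 normcM.
Qed.

(** The reflection in the unit circle takes [z] out of the open unit disk, hence out of the hole,
    and the second reflection brings it into the hole. In numbers, [r <= 1 - |c|]. *)
Lemma T_in_hole j z : normc z <= 1 -> cdisk (center D j) (radius D j) (T_ j z).
Proof.
move=> z1; rewrite /cdisk /= T_E ?unit_rho // /moeb (addrC (center D j)) addrK.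
have r0 := radius_gt0 j; have cr := holes_in_unit j.
rewrite 2!normcM normcV normc_realp ?sqr_ge0 //.
have := one_sub_normc_ge (center D j)^* z; rewrite normc_conj.
have := ler_wpM2l (normc_ge0 (center D j)) z1; rewrite mulr1 => h1 h2.
rewrite ler_pdivrMr; last by lra.
rewrite expr2 -mulrA ler_wpM2l ?(ltW r0) //.
by apply: (@le_trans _ _ (radius D j)); [rewrite ler_piMr // ltW|lra].
Qed.

Lemma T_unit j z : normc z <= 1 -> normc (T_ j z) < 1.
Proof.
by move=> /(T_in_hole j) /(@hole_sub _ D j); rewrite /disk /= subr0.
Qed.

Lemma Tword_unit w z : normc z <= 1 -> normc (Tword w z) <= 1.
Proof. by move=> z1; elim: w => //= j w IH; exact/ltW/T_unit. Qed.

Lemma T_inj j z z' : normc z <= 1 -> normc z' <= 1 -> T_ j z = T_ j z' -> z = z'.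
Proof.
move=> z1 z1' /eqP; rewrite -subr_eq0 T_sub ?unit_rho //.
have n0 y : normc y <= 1 -> sqD j y != 0.
  move=> y1; rewrite mulf_neq0 ?invr_eq0 ?denom_neq0 ?unit_rho //.
  by rewrite fmorph_eq0 lt0r_neq0 // radius_gt0.
by rewrite 2!mulf_eq0 (negbTE (n0 _ z1)) (negbTE (n0 _ z1')) !orbF subr_eq0 => /eqP.
Qed.

Lemma exists_notin_hole j :
  exists2 z : R[i], normc z <= 1 & ~ cdisk (center D j) (radius D j) z.
Proof.
have c1 := holes_in_unit j; exists 1; first by rewrite normc1.
rewrite /cdisk /=; have := normcB_ge 1 (center D j); rewrite normc1.
by move=> h; apply/negP; rewrite -ltNge; lra.
Qed.

(** Ping-pong: the outermost letter is known from the hole in which the images lie, and it can be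
    cancelled because [T_ i] is injective. The empty word differs from the others since no hole
    fills the closed unit disk. *)
Lemma Tword_inj_on w w' :
  (forall z, normc z <= 1 -> Tword w z = Tword w' z) -> w = w'.
Proof.
elim: w w' => [|i w IH] [|j w'] //= H.
- have [z z1 []] := exists_notin_hole j.
  by rewrite (H z z1); apply: T_in_hole; exact: Tword_unit.
- have [z z1 []] := exists_notin_hole i.
  by rewrite -(H z z1); apply: T_in_hole; exact: Tword_unit.
have [ij|nij] := eqVneq i j; last first.
  have := hole_disj nij => /seteqP[sub _]; exfalso; apply: (sub (T_ i (Tword w 0))).
  split; first by apply: T_in_hole; rewrite Tword_unit // normc0 ler01.
  by rewrite H ?normc0 ?ler01 //; apply: T_in_hole; rewrite Tword_unit // normc0 ler01.
subst j; congr cons; apply: IH => z z1.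
by apply: (@T_inj i); rewrite ?Tword_unit ?H.
Qed.

Lemma Tword_inj : injective (@Tword R D).
Proof. by move=> w w' e; apply: Tword_inj_on => z _; rewrite e. Qed.

End Words.

(** * Reduction to derivatives at 0 *)

Section UnorderedSums.
Variable R : realType.

Lemma fsum_le (I : choiceType) (F : set I) (f g : I -> R) : finite_set F ->
  (forall i, F i -> f i <= g i) -> \sum_(i \in F) f i <= \sum_(i \in F) g i.
Proof.
move=> Ffin fg; rewrite !fsbig_finite // big_seq [leRHS]big_seq.
by apply: ler_sum => i; rewrite in_fset_set // inE => /fg.
Qed.

Lemma fsumZ (I : choiceType) (F : set I) (f : I -> R) (K : R) : finite_set F ->
  \sum_(i \in F) (K * f i) = K * \sum_(i \in F) f i.
Proof. by move=> Ffin; rewrite !fsbig_finite // mulr_sumr. Qed.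

Lemma fsum_subset (I : choiceType) (F G : set I) (f : I -> R) :
  finite_set G -> F `<=` G -> (forall i, G i -> 0 <= f i) ->
  \sum_(i \in F) f i <= \sum_(i \in G) f i.
Proof.
move=> Gfin FG f0; rewrite (fsbigID F G) //= (_ : G `&` F = F).
  by rewrite lerDl fsumr_ge0 // => i [/f0].
by apply/seteqP; split => [i []//|i Fi]; split => //; exact: FG.
Qed.

Lemma fsum_setD (I : choiceType) (F G : set I) (f : I -> R) :
  finite_set G -> F `<=` G ->
  \sum_(i \in G) f i = \sum_(i \in F) f i + \sum_(i \in G `&` ~` F) f i.
Proof.
move=> Gfin FG; rewrite (fsbigID F G) //= (_ : G `&` F = F) //.
by apply/seteqP; split => [i []//|i Fi]; split => //; exact: FG.
Qed.

(** All terms are nonnegative, so the supremum of the finite partial sums serves as the sum, and a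
    tail is at most [K] times what the majorant still lacks of its supremum. *)
Lemma weierstrass_M_test (I : choiceType) (Omega : set R[i]) (A : set I)
    (f : I -> R[i] -> R) (b : I -> R) (M : R) :
  (forall i, A i -> 0 <= b i) ->
  (forall F, finite_set F -> F `<=` A -> \sum_(i \in F) b i <= M) ->
  (forall z0, Omega z0 -> exists2 d : R, 0 < d & exists2 K : R, 0 <= K &
     forall z i, disk z0 d z -> Omega z -> A i -> 0 <= f i z <= K * b i) ->
  loc_unif_cvg_series Omega A f.
Proof.
move=> b0 bM fb.
pose Sset z := [set \sum_(i \in F) f i z | F in [set F | finite_set F /\ F `<=` A]].
pose Bset := [set \sum_(i \in F) b i | F in [set F | finite_set F /\ F `<=` A]].
have Bsup : has_sup Bset.
  split.
    by exists (\sum_(i \in set0) b i), set0 => //;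
      split; [exact: finite_set0|exact: sub0set].
  by exists M => _ [F [Ff FA] <-]; exact: bM.
exists (fun z => sup (Sset z)) => z0 /fb[d d0 [K K0 H]]; exists d => // e e0.
have K1 : 0 < K + 1 by rewrite ltr_wpDl.
have [|_ [F [Ff FA] <-] HF] := @sup_adherent _ Bset (e / (K + 1)) _ Bsup.
  by rewrite divr_gt0.
exists F; split => // G Gf FG GA z zd zO.
have fK i : A i -> 0 <= f i z <= K * b i by exact: H.
have Ssup : has_sup (Sset z).
  split.
    by exists (\sum_(i \in set0) f i z), set0 => //;
      split; [exact: finite_set0|exact: sub0set].
  exists (K * M) => _ [G' [G'f G'A] <-].
  apply: (@le_trans _ _ (\sum_(i \in G') (K * b i))).
    by apply: fsum_le => // i /G'A/fK/andP[].
  by rewrite fsumZ // ler_wpM2l // bM.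
have low : \sum_(i \in G) f i z <= sup (Sset z).
  by apply: sup_upper_bound => //; exists G.
(* Any finite partial sum grows when [G] is added to it; the terms outside [G] are then compared
   with the majorant, which has at least its [F]-part in [G]. *)
have up : sup (Sset z) <= \sum_(i \in G) f i z + K * (sup Bset - \sum_(i \in F) b i).
  apply: ge_sup; first by case: Ssup.
  move=> _ [G' [G'f G'A] <-].
  have Uf : finite_set (G `|` G') by rewrite finite_setU.
  have UA : G `|` G' `<=` A by move=> i [/GA|/G'A].
  apply: (@le_trans _ _ (\sum_(i \in G `|` G') f i z)).
    by apply: fsum_subset => // i /UA/fK/andP[].
  rewrite (@fsum_setD _ G) // lerD2l.
  have Df : finite_set ((G `|` G') `&` ~` G) by exact: finite_setIl.
  apply: (@le_trans _ _ (\sum_(i \in (G `|` G') `&` ~` G) (K * b i))).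
    by apply: fsum_le => // i [/UA/fK/andP[]].
  rewrite fsumZ // ler_wpM2l //.
  have : \sum_(i \in G `|` G') b i <= sup Bset.
    by apply: sup_upper_bound => //; exists (G `|` G').
  rewrite (@fsum_setD _ G) // => h.
  have : \sum_(i \in F) b i <= \sum_(i \in G) b i.
    by apply: fsum_subset => // i /GA/b0.
  lra.
have : K * (sup Bset - \sum_(i \in F) b i) < e.
  apply: (@le_lt_trans _ _ (K * (e / (K + 1)))); first by rewrite ler_wpM2l //; lra.
  by rewrite mulrA ltr_pdivrMr // mulrC ltr_pM2l //; lra.
by rewrite ltr_norml; lra.
Qed.

End UnorderedSums.

Section Criterion.
Variables (R : realType) (D : cmcd R).
Implicit Types (j : 'I_(holes D)) (w : seq 'I_(holes D)) (z : R[i]).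

(* By bounded distortion, Assumption A only depends on the derivatives at 0. *)
Definition wsummable := exists M : R, forall s : seq (seq 'I_(holes D)), uniq s ->
  \sum_(w <- s) normc (sqDword w 0) ^+ 2 <= M.

Lemma Tfam_word tau : Tfam D tau -> exists w, tau = Tword w.
Proof. by case=> [[w _ ->]|->]; [exists w|exists [::]]. Qed.

Lemma word_Tfam w : Tfam D (Tword w).
Proof. by case: w => [|j w]; [right|left; exists (j :: w)]. Qed.

Lemma wsummable_assumptionA : wsummable -> assumptionA D.
Proof.
move=> [M HM].
(* The series is indexed by functions and the majorant by words. On [Tfam D] this choice is a right
   inverse of [Tword], hence injective. *)
pose wof (tau : R[i] -> R[i]) := xget [::] [set w | tau = @Tword R D w].
have wofK tau : Tfam D tau -> Tword (wof tau) = tau.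
  move=> /Tfam_word h; rewrite /wof.
  by by have := @xgetPex _ [::] [set w | tau = @Tword R D w] h => /= <-.
apply: (@weierstrass_M_test _ _ _ _ _ (fun tau => normc (sqDword (wof tau) 0) ^+ 2) M).
- by move=> tau _; exact: sqr_ge0.
- move=> F Ff FA; rewrite fsbig_finite //=.
  rewrite -(big_map wof predT (fun w => normc (sqDword w 0) ^+ 2)).
  apply: HM; rewrite map_inj_in_uniq ?finmap.fset_uniq // => t t'.
  rewrite !in_fset_set // !inE => /FA/wofK {2}<- /FA/wofK {2}<- ->.
  by [].
move=> z0 /bigdiskE z01; set q := 1 - rho D * normc z0.
have q0 : 0 < q by rewrite subr_gt0.
exists (q / 2); first by rewrite divr_gt0.
(* On the disk of radius [q / 2] about [z0] one has [1 - rho |z| >= q / 2], and [sqDword_le]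
   applies. *)
exists ((q / 2)^-1 ^+ 2); first exact: sqr_ge0.
move=> z tau; rewrite /disk /= => zz0 /bigdiskE z1 /wofK e.
rewrite -{1 2}e Tword_cderive // sqr_ge0 /= -exprMn.
have zq : q / 2 <= 1 - rho D * normc z.
  have := normcB_ge z z0; have := rho_lt1 D; have := rho_ge0 D.
  move=> r0 r1 zz; have q2 : 0 <= q / 2 by lra.
  have := ler_wpM2l r0 (le_trans zz (ltW zz0)).
  have : rho D * (q / 2) <= q / 2 by rewrite ler_piMl // ltW.
  rewrite mulrBr /q; lra.
rewrite ler_sqr ?nnegrE ?mulr_ge0 ?invr_ge0 ?normc_ge0 ?divr_ge0 ?(ltW q0) //.
rewrite mulrC ler_pdivlMr ?divr_gt0 //.
apply: le_trans (sqDword_le (wof tau) z1).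
by rewrite ler_wpM2l ?normc_ge0.
Qed.

(** Convergence at the single point 0 with tolerance 1 is enough: joined with [F], every finite
    family has a sum below [S 0 + 1], and dropping nonnegative terms keeps the bound. Distinct words
    count separately by [Tword_inj]. *)
Lemma assumptionA_wsummable : assumptionA D -> wsummable.
Proof.
move=> [S /(_ 0)]; have d0 : bigdisk D 0.
  by apply/bigdiskE; rewrite normc0 mulr0 ltr01.
move=> /(_ d0)[d dp /(_ 1 ltr01)[F [Ff FA H]]].
exists (S 0 + 1) => s us.
pose G := [set` [seq Tword w | w <- s]].
have Gf : finite_set G by exact: finite_seq.
have GA : G `<=` Tfam D by move=> _ /mapP[w _ ->]; exact: word_Tfam.
have Uf : finite_set (F `|` G) by rewrite finite_setU.
have := H (F `|` G) Uf (@subsetUl _ F G) _ 0 _ d0.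
move=> /(_ _ _)/wrap[].
  by move=> t [/FA|/GA].
  by suff : normc (0 - 0 : R[i]) < d by []; rewrite subr0 normc0.
rewrite ltr_norml => /andP[_ h].
apply: (@le_trans _ _ (\sum_(t \in F `|` G) normc (cderive t 0))); last by lra.
apply: (@le_trans _ _ (\sum_(t \in G) normc (cderive t 0))).
  rewrite -fsbig_seq ?map_inj_uniq //; last exact: Tword_inj.
  rewrite big_map; apply: ler_sum => w _; rewrite Tword_cderive //.
  by rewrite normc0 mulr0 ltr01.
by apply: fsum_subset => // t _; exact: normc_ge0.
Qed.

(** The words of length strictly less than [N], listed so that sums split according to the outermost
    letter. *)
Fixpoint allw N : seq (seq 'I_(holes D)) :=
  if N is N'.+1 then [::] :: [seq j :: w | j <- enum 'I_(holes D), w <- allw N']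
  else [::].

Lemma mem_allw N w : (size w < N)%N -> w \in allw N.
Proof.
elim: N w => [|N IH] [|j w] //= h; rewrite inE; apply/orP; right.
by apply/allpairsP; exists (j, w); split; rewrite ?mem_enum ?IH.
Qed.

Lemma big_allwS N (f : seq 'I_(holes D) -> R) :
  \sum_(w <- allw N.+1) f w = f [::] + \sum_j \sum_(w <- allw N) f (j :: w).
Proof. by rewrite /= big_cons big_allpairs_dep big_enum. Qed.

Lemma sum_uniq_subset (I : eqType) (f : I -> R) (s t : seq I) :
  (forall i, 0 <= f i) -> uniq s -> {subset s <= t} ->
  \sum_(i <- s) f i <= \sum_(i <- t) f i.
Proof.
move=> f0; elim: s t => [|x s IH] t /=; first by rewrite big_nil sumr_ge0.
move=> /andP[xs us] st; have xt : x \in t by apply: st; rewrite inE eqxx.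
rewrite (perm_big _ (perm_to_rem xt)) /= !big_cons lerD2l; apply: IH => // y ys.
have := st y; rewrite inE ys orbT (perm_mem (perm_to_rem xt)) inE => /(_ isT).
by case: eqVneq => // yx; rewrite -yx ys in xs.
Qed.

Lemma wsummable_allw M :
  (forall N, \sum_(w <- allw N) normc (sqDword w 0) ^+ 2 <= M) -> wsummable.
Proof.
move=> H; exists M => s us.
apply: le_trans (H (\max_(w <- s) size w).+1); apply: sum_uniq_subset => //.
- by move=> w; exact: sqr_ge0.
- by move=> w ws; apply: mem_allw; rewrite ltnS (big_rem w) //= leq_maxl.
Qed.

Lemma condition_ii_wsummable : condition_ii D -> wsummable.
Proof.
rewrite /condition_ii; set q := \sum_(j < _) _ => q1.
have q0 : 0 <= q by apply: sumr_ge0 => j _; rewrite divr_ge0 ?sqr_ge0.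
have r0 := rho_ge0 D; have r1 := rho_lt1 D.
have rw w z : normc z <= rho D -> normc (Tword w z) <= rho D.
  by move=> zr; elim: w => //= j w IH; apply: T_le => //; nra.
have rz z : normc z <= rho D -> rho D * normc z < 1.
  by move=> zr; apply: unit_rho; lra.
have sqDq z : normc z <= rho D -> \sum_(j < holes D) normc (sqD j z) ^+ 2 <= q.
  move=> zr; apply: ler_sum => j _; rewrite /sqD normcM normcV.
  rewrite normc_realp ?(ltW (radius_gt0 j)) // expr_div_n.
  rewrite ler_pM2l ?exprn_gt0 ?radius_gt0 //.
  have c1 := center_le_rho j; have c0 := normc_ge0 (center D j).
  have dp : 0 < 1 - normc (center D j) * rho D by nra.
  have dge : 1 - normc (center D j) * rho D <= normc (1 - (center D j)^* * z).
    have := one_sub_normc_ge (center D j)^* z; rewrite normc_conj; nra.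
  rewrite lef_pV2 ?posrE ?exprn_gt0 // ?(lt_le_trans dp) //.
  by rewrite ler_sqr // ?nnegrE ?normc_ge0 // ltW.
(* The bound is the fixed point of [x -> 1 + q x]: the empty word contributes 1 and a new outermost
   letter at most a factor [q]. *)
apply: (@wsummable_allw (1 - q)^-1) => N.
elim: N => [|N IH]; first by rewrite big_nil invr_ge0; lra.
rewrite big_allwS (_ : normc (sqDword [::] 0) = 1); last exact: normc1.
rewrite expr1n exchange_big /=.
have := ler_wpM2l q0 IH.
rewrite mulr_sumr => h.
have e : 1 + q * (1 - q)^-1 = (1 - q)^-1 by field; lra.
rewrite -e lerD2l; apply: le_trans h.
apply: ler_sum => w _.
under eq_bigr do rewrite normcM exprMn.
by rewrite -mulr_suml ler_wpM2r ?sqr_ge0 // sqDq // rw // normc0.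
Qed.

End Criterion.

(** * Centers on the real line *)

Section Packing.
Variable R : realType.

(** The first interval serves as a pivot, as in quicksort: the others lie in [[u, p j]] or in
    [[q j, v]]. Both sublists are shorter but not tails, hence the induction on a bound for the
    size. *)
Lemma packing (I : eqType) (F : R -> R) (p q : I -> R) (s : seq I) (u v : R) :
  u <= v -> (forall x y, u <= x -> x <= y -> y <= v -> F x <= F y) -> uniq s ->
  {in s, forall i, [/\ u <= p i, p i <= q i & q i <= v]} ->
  {in s &, forall i j, i != j -> q i < p j \/ q j < p i} ->
  \sum_(i <- s) (F (q i) - F (p i)) <= F v - F u.
Proof.
have [n sn] := ubnP (size s); elim: n s u v sn => // n IH [|j s] u v.
  by move=> _ uv mF *; rewrite big_nil subr_ge0 mF.
rewrite /= ltnS => sn uv mF /andP[js us] pq sep.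
have [uj pqj jv] := pq j (mem_head j s).
have sj i : i \in s -> i \in j :: s by move=> h; rewrite inE h orbT.
rewrite big_cons (bigID (fun i => q i < p j)) /=.
rewrite -(big_filter s (fun i => q i < p j)) -(big_filter s (fun i => ~~ (q i < p j))).
have h1 : \sum_(i <- [seq i <- s | q i < p j]) (F (q i) - F (p i)) <= F (p j) - F u.
  apply: IH => //.
  - by rewrite (leq_ltn_trans _ sn) // size_filter count_size.
  - by move=> x y ux xy yj; apply: mF => //; lra.
  - by rewrite filter_uniq.
  - by move=> i; rewrite mem_filter => /andP[ij /sj/pq[h1 h2 h3]]; split => //; exact: ltW.
  - by move=> i k; rewrite !mem_filter => /andP[_ /sj hi] /andP[_ /sj hk]; exact: sep.
have h2 : \sum_(i <- [seq i <- s | ~~ (q i < p j)]) (F (q i) - F (p i)) <= F v - F (q j).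
  apply: IH => //.
  - by rewrite (leq_ltn_trans _ sn) // size_filter count_size.
  - by move=> x y ux xy yj; apply: mF => //; lra.
  - by rewrite filter_uniq.
  - move=> i; rewrite mem_filter -leNgt => /andP[ij si].
    have [k1 k2 k3] := pq _ (sj _ si); split => //.
    have ne : i != j by apply: contraNneq js => <-.
    by have [] := sep _ _ (sj _ si) (mem_head j s) ne; [rewrite ltNge ij|exact: ltW].
  - by move=> i k; rewrite !mem_filter => /andP[_ /sj hi] /andP[_ /sj hk]; exact: sep.
lra.
Qed.

Lemma disjoint_cdisk (c c' : R[i]) (r r' : R) : 0 < r -> 0 < r' ->
  cdisk c r `&` cdisk c' r' = set0 -> r + r' < normc (c - c').
Proof.
move=> r0 r0' /seteqP[sub _]; rewrite ltNge; apply/negP => h.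
have rr : 0 < r + r' by rewrite addr_gt0.
(* The point dividing the segment of the centers in the ratio [r : r'] would lie in both disks. *)
apply: (sub (c + (c' - c) * (r / (r + r'))%:C)); split; rewrite /cdisk /=.
  rewrite (_ : _ - c = (c' - c) * (r / (r + r'))%:C); last by ring.
  rewrite normcM normcBC normc_realp ?divr_ge0 ?(ltW r0) ?(ltW rr) //.
  by rewrite mulrCA ler_piMr ?(ltW r0) // ler_pdivrMr // mul1r.
have e : (r / (r + r'))%:C = 1 - (r' / (r + r'))%:C :> R[i].
  rewrite -[1](rmorph1 (real_complex R)) -rmorphB; congr (_%:C).
  by field; exact: lt0r_neq0.
rewrite (_ : _ - c' = (c - c') * (r' / (r + r'))%:C); last by rewrite e; ring.
rewrite normcM normc_realp ?divr_ge0 ?(ltW r0') ?(ltW rr) //.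
by rewrite mulrCA ler_piMr ?(ltW r0') // ler_pdivrMr // mul1r.
Qed.

End Packing.

Section RealCenters.
Variables (R : realType) (D : cmcd R).
Hypothesis Dreal : condition_i D.
Implicit Types (j : 'I_(holes D)) (w : seq 'I_(holes D)) (x : R).

Let c j : R := Re (center D j).
Let r j : R := radius D j.

Let cE j : center D j = (c j)%:C.
Proof. by have [x _ e] := Dreal j; rewrite /c e. Qed.

Definition Treal j x : R := c j + r j ^+ 2 * x / (1 - c j * x).

Definition Tword_real w x : R := foldr Treal x w.

Let cr1 j : `|c j| + r j < 1.
Proof. by have := holes_in_unit j; rewrite cE normc_real. Qed.

Lemma Treal_E j x : `|x| <= 1 -> T_ j x%:C = (Treal j x)%:C.
Proof.
move=> x1; rewrite T_E; last by rewrite unit_rho // normc_real.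
rewrite /moeb cE conjcR -/(r j) /Treal rmorphD fmorph_div rmorphB rmorph1.
by rewrite (rmorphM (real_complex R) (r j ^+ 2)) (rmorphM (real_complex R) (c j)).
Qed.

Lemma Treal_hole j x : `|x| <= 1 -> `|Treal j x - c j| <= r j.
Proof.
move=> x1; have := @T_in_hole _ _ j x%:C; rewrite normc_real => /(_ x1).
by rewrite /cdisk /= Treal_E // cE -rmorphB normc_real.
Qed.

Lemma Treal_unit j x : `|x| <= 1 -> `|Treal j x| <= 1.
Proof.
move=> x1; have := @T_unit _ _ j x%:C; rewrite normc_real => /(_ x1).
by rewrite Treal_E // normc_real => /ltW.
Qed.

Lemma Treal_le j x y : `|x| <= 1 -> `|y| <= 1 -> x <= y -> Treal j x <= Treal j y.
Proof.
move=> x1 y1 xy; have := cr1 j; have := radius_gt0 j; rewrite -/(r j) => r0 cr.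
have d0 z : `|z| <= 1 -> 0 < 1 - c j * z.
  move=> z1; rewrite subr_gt0; apply: le_lt_trans (ler_norm _) _.
  rewrite normrM; apply: (@le_lt_trans _ _ `|c j|); last by lra.
  by rewrite ler_piMr.
have dx := d0 _ x1; have dy := d0 _ y1.
rewrite -subr_ge0 /Treal.
rewrite (_ : _ - _ = (y - x) * (r j / (1 - c j * x)) * (r j / (1 - c j * y))).
  by rewrite !mulr_ge0 ?subr_ge0 ?invr_ge0 // ltW.
by field; rewrite !lt0r_neq0.
Qed.

Lemma Tword_real_unit w x : `|x| <= 1 -> `|Tword_real w x| <= 1.
Proof. by move=> x1; elim: w => //= j w IH; exact: Treal_unit. Qed.

Lemma Tword_realE w x : `|x| <= 1 -> Tword w x%:C = (Tword_real w x)%:C.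
Proof.
by move=> x1; elim: w => //= j w ->; rewrite Treal_E // Tword_real_unit.
Qed.

Lemma Tword_real_le w x y : `|x| <= 1 -> `|y| <= 1 -> x <= y ->
  Tword_real w x <= Tword_real w y.
Proof.
move=> x1 y1 xy; elim: w => //= j w IH.
by apply: Treal_le; rewrite ?Tword_real_unit.
Qed.

Definition rightmost : R := \big[Num.max/-1]_(j < holes D) (c j + r j).

Lemma rightmost_ge : -1 <= rightmost. Proof. exact: bigmax_ge_id. Qed.

Lemma rightmost_lt1 : rightmost < 1.
Proof.
apply: bigmax_lt => [|j _]; first by lra.
by have := cr1 j; have := ler_norm (c j); lra.
Qed.

Lemma le_rightmost j : c j + r j <= rightmost.
Proof. exact: (le_bigmax_cond (-1) (fun j => c j + r j)). Qed.

Lemma holes_separated i j : i != j -> c i + r i < c j - r j \/ c j + r j < c i - r i.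
Proof.
move=> /hole_disj/(disjoint_cdisk (radius_gt0 i) (radius_gt0 j)).
rewrite !cE -rmorphB normc_real -/(r i) -/(r j) ltr_normr => /orP[] h; [right|left]; lra.
Qed.

(* The images of the gap [rightmost, 1] under all words are non-overlapping. *)
Lemma sum_gaps N (F : R -> R) :
  (forall x y, -1 <= x -> x <= y -> y <= 1 -> F x <= F y) ->
  \sum_(w <- allw D N) (F (Tword_real w 1) - F (Tword_real w rightmost))
    <= F 1 - F (-1).
Proof.
have m0 := rightmost_ge; have m1 := rightmost_lt1.
elim: N F => [|N IH] F mF; first by rewrite big_nil subr_ge0 mF //; lra.
rewrite big_allwS /=.
(* The empty word takes up the gap itself; all other words share what lies to its left. *)
have -> : F 1 - F (-1) = F 1 - F rightmost + (F rightmost - F (-1)) by ring.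
rewrite lerD2l.
have abs1 x : -1 <= x -> x <= 1 -> `|x| <= 1 by rewrite ler_norml => -> ->.
apply: (@le_trans _ _ (\sum_j (F (Treal j 1) - F (Treal j (-1))))).
  (* Here the generality of [F] pays: stripping the outermost letter replaces [F] by [F \o Treal j],
     which is still increasing. *)
  apply: ler_sum => j _; apply: (IH (F \o Treal j)) => x y x1 xy y1 /=.
  have ax : `|x| <= 1 by apply: abs1 => //; lra.
  have ay : `|y| <= 1 by apply: abs1 => //; lra.
  have := Treal_unit j ax; have := Treal_unit j ay; rewrite !ler_norml.
  by move=> /andP[? ?] /andP[? ?]; apply: mF => //; exact: Treal_le.
apply: (@le_trans _ _ (\sum_j (F (c j + r j) - F (c j - r j)))).
  apply: ler_sum => j _.
  have /(Treal_hole j) : `|1 : R| <= 1 by rewrite normr1.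
  have /(Treal_hole j) : `|-1 : R| <= 1 by rewrite normrN1.
  have := cr1 j; have := ler_norm (c j); have := ler_norm (- c j); rewrite normrN.
  rewrite !ler_norml => n1 n2 n3 /andP[a1 a2] /andP[b1 b2].
  by apply: lerB; apply: mF; lra.
apply: packing => //.
- by move=> x y *; apply: mF => //; lra.
- exact: index_enum_uniq.
- move=> j _; have := cr1 j; have := ler_norm (- c j); rewrite normrN.
  by have := radius_gt0 j; have := le_rightmost j; rewrite -/(r j); split; lra.
- by move=> i j _ _; exact: holes_separated.
Qed.

Lemma condition_i_wsummable : wsummable D.
Proof.
have m0 := rightmost_ge; have m1 := rightmost_lt1.
have a1 : `|1 : R| <= 1 by rewrite normr1.
have am : `|rightmost| <= 1 by rewrite ler_norml m0 ltW.
have d0 : 0 < 1 - rightmost by rewrite subr_gt0.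
(* The images have total length at most 2, and [sqDword_ge] at both ends of the gap costs a factor
   4. *)
apply: (@wsummable_allw _ _ (8 / (1 - rightmost))) => N.
have : \sum_(w <- allw D N) (Tword_real w 1 - Tword_real w rightmost) <= 1 - (-1).
  by apply: (@sum_gaps N id).
move=> h; have {h} : 4 / (1 - rightmost) *
    \sum_(w <- allw D N) (Tword_real w 1 - Tword_real w rightmost)
    <= 8 / (1 - rightmost).
  apply: le_trans (ler_wpM2l _ h) _; first by rewrite divr_ge0 // ltW.
  by rewrite mulrAC ler_pM2r ?invr_gt0 //; lra.
apply: le_trans; rewrite mulr_sumr; apply: ler_sum => w _.
have : normc ((Tword_real w 1)%:C - (Tword_real w rightmost)%:C : R[i]) =
   (1 - rightmost) * normc (sqDword w 1) * normc (sqDword w rightmost%:C).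
  rewrite -!Tword_realE // Tword_sub ?unit_rho ?normc_real // 2!normcM.
  by rewrite -rmorphB normc_realp // ltW.
rewrite -rmorphB normc_realp; last first.
  by rewrite subr_ge0 Tword_real_le // ltW.
move=> ->; rewrite 2!mulrA divfK ?lt0r_neq0 //.
have k1 : normc (sqDword w 0) <= 2 * normc (sqDword w 1).
  by apply: sqDword_ge; rewrite normc1.
have k2 : normc (sqDword w 0) <= 2 * normc (sqDword w rightmost%:C).
  by apply: sqDword_ge; rewrite normc_real.
have := ler_pM (normc_ge0 _) (normc_ge0 _) k1 k2; rewrite -expr2; lra.
Qed.

End RealCenters.

(** * Goursat's theorem *)

Section Primitives.
Variable R : realType.
Implicit Types (a b c d x y u v : R).

Lemma exists_primitive (k : R -> R) a b : a < b ->
  (forall x, a <= x <= b -> {for x, continuous k}) ->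
  exists G : R -> R, forall x, a < x < b -> is_derive x 1 G (k x).
Proof.
move=> ab kc; pose mu := @lebesgue_measure R.
have ki : mu.-integrable `[a, b] (EFin \o k).
  apply: continuous_compact_integrable; first exact: segment_compact.
  apply: continuous_in_subspaceT => x; rewrite inE /= in_itv /= => xab.
  exact: kc.
exists (fun x => \int[mu]_(t in `[a, x]) k t)%R => x /andP[ax xb].
have kx : {for x, continuous k} by apply: kc; rewrite !ltW.
have [//|h1 h2] := @continuous_FTC1 R k (BLeft a) x b xb ki _ kx.
by apply: DeriveDef; [exact: h1|rewrite -derive1E; exact: h2].
Qed.

(** Stated for real and imaginary parts, so that the real fundamental theorem and mean value theorem
    apply. *)
Definition cprim (G k : R -> R[i]) a b := forall x, a < x < b ->
  is_derive x 1 (fun x => Re (G x)) (Re (k x)) /\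
  is_derive x 1 (fun x => Im (G x)) (Im (k x)).

Lemma exists_cprim (k : R -> R[i]) a b : a < b ->
  (forall x, a <= x <= b -> {for x, continuous (fun x => Re (k x))}) ->
  (forall x, a <= x <= b -> {for x, continuous (fun x => Im (k x))}) ->
  exists G, cprim G k a b.
Proof.
move=> ab /(exists_primitive ab)[U HU] /(exists_primitive ab)[V HV].
by exists (fun x => U x +i* V x) => x xab; split; [exact: HU|exact: HV].
Qed.

Lemma cprimB G k G' k' a b : cprim G k a b -> cprim G' k' a b ->
  cprim (fun x => G x - G' x) (fun x => k x - k' x) a b.
Proof.
move=> h h' x xab; have [h1 h2] := h x xab; have [h1' h2'] := h' x xab.
split.
  rewrite (_ : (fun x => _) = (fun x => Re (G x)) - (fun x => Re (G' x))); last first.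
    by apply/funext => t; rewrite raddfB.
  by rewrite raddfB; exact: is_deriveB.
rewrite (_ : (fun x => _) = (fun x => Im (G x)) - (fun x => Im (G' x))); last first.
  by apply/funext => t; rewrite raddfB.
by rewrite raddfB; exact: is_deriveB.
Qed.

Lemma cprim_quadratic (p q : R[i]) a b :
  cprim (fun x => p * x%:C + q * (x ^+ 2)%:C) (fun x => p + q * (2 * x)%:C) a b.
Proof.
case: p q => p1 p2 [q1 q2] x _; split.
  rewrite (_ : (fun x => _) = (fun x => p1 * x + q1 * x ^+ 2)); last first.
    by apply/funext => t; simpc.
  by simpc => /=; apply: is_derive_eq; rewrite /GRing.scale /=; ring.
rewrite (_ : (fun x => _) = (fun x => p2 * x + q2 * x ^+ 2)); last first.
  by apply/funext => t; simpc => /=; ring.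
by simpc => /=; apply: is_derive_eq; rewrite /GRing.scale /=; ring.
Qed.

Lemma Re_mulconj_le (z w : R[i]) : Re z * Re w + Im z * Im w <= normc z * normc w.
Proof.
have -> : Re z * Re w + Im z * Im w = Re (z * w^*).
  by case: z w => [x y] [x' y'] /=; rewrite mulrN opprK.
by apply: le_trans (Re_le_normc _) _; rewrite normcM normc_conj.
Qed.

(** A complex function has no mean value equality; the real theorem is applied to the inner product
    of [G] with the fixed vector [G b - G a]. *)
Lemma cprim_mean_value G k a0 b0 a b M : cprim G k a0 b0 -> a0 < a -> a <= b ->
  b < b0 -> (forall x, a <= x <= b -> normc (k x) <= M) ->
  normc (G b - G a) <= M * (b - a).
Proof.
move=> Gk a0a ab bb0 kM; set z := G b - G a.
have inab x : a <= x <= b -> a0 < x < b0 by move=> /andP[? ?]; apply/andP; split; lra.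
have [->|z0] := eqVneq z 0.
  have M0 : 0 <= M by apply: le_trans (kM a _); rewrite ?normc_ge0 // lexx.
  by rewrite normc0 mulr_ge0 // subr_ge0.
pose W x := Re z * Re (G x) + Im z * Im (G x).
have dW x : a <= x <= b -> is_derive x 1 W (Re z * Re (k x) + Im z * Im (k x)).
  move=> /inab/Gk[h1 h2].
  exact: (is_deriveD (is_deriveZ (Re z) h1) (is_deriveZ (Im z) h2)).
have [||xi] := @MVT_segment _ W (fun x => Re z * Re (k x) + Im z * Im (k x)) a b ab.
- by move=> x; rewrite in_itv /= => /andP[/ltW h1 /ltW h2]; apply: dW; rewrite h1.
- apply: continuous_in_subspaceT => x; rewrite inE /= in_itv /= => /dW[h _].
  exact/differentiable_continuous/derivable1_diffP.
rewrite in_itv /= => xi_in e.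
have : normc z ^+ 2 <= normc z * M * (b - a).
  have -> : normc z ^+ 2 = W b - W a.
    by rewrite sqr_normcE /W /z !raddfB /=; ring.
  rewrite e ler_wpM2r ?subr_ge0 //; apply: le_trans (Re_mulconj_le _ _) _.
  by rewrite ler_wpM2l ?normc_ge0 // kM.
by rewrite expr2 -mulrA ler_pM2l // normc_gt0.
Qed.

(** Nested rectangles with sides [w / 2 ^+ n] and [h / 2 ^+ n], given by their lower left corners;
    the common point is the supremum of these corners. *)
Lemma bisection (bad : R -> R -> nat -> Prop) (w h : R) (a0 c0 : R) :
  0 <= w -> 0 <= h ->
  (forall n a c, bad a c n -> exists a' c',
     [/\ a <= a' <= a + w / 2 ^+ n.+1, c <= c' <= c + h / 2 ^+ n.+1 & bad a' c' n.+1]) ->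
  bad a0 c0 0%N ->
  exists p q, forall n, exists a c,
    [/\ bad a c n, a <= p <= a + w / 2 ^+ n & c <= q <= c + h / 2 ^+ n].
Proof.
move=> w0 h0 step bad0.
(* The step is made total, with an arbitrary value at rectangles that are not bad, so that it can be
   iterated. *)
have /choice[f Hf] : forall t : nat * (R * R), exists ac' : R * R,
    bad t.2.1 t.2.2 t.1 ->
     [/\ t.2.1 <= ac'.1 <= t.2.1 + w / 2 ^+ t.1.+1,
         t.2.2 <= ac'.2 <= t.2.2 + h / 2 ^+ t.1.+1 & bad ac'.1 ac'.2 t.1.+1].
  move=> [n [a c]] /=; have [/step[a' [c' H]]|nb] := pselect (bad a c n).
    by exists (a', c').
  by exists (a, c).
pose s := fix s n : R * R := if n is n'.+1 then f (n', s n') else (a0, c0).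
have bads n : bad (s n).1 (s n).2 n.
  by elim: n => //= n IH; have [] := Hf (n, s n) IH.
have half (t : R) n : t / 2 ^+ n = t / 2 ^+ n.+1 + t / 2 ^+ n.+1.
  by rewrite exprS; field; rewrite expf_neq0.
have nest n k : [/\ (s n).1 <= (s (n + k)%N).1,
    (s (n + k)%N).1 + w / 2 ^+ (n + k) <= (s n).1 + w / 2 ^+ n,
    (s n).2 <= (s (n + k)%N).2 &
    (s (n + k)%N).2 + h / 2 ^+ (n + k) <= (s n).2 + h / 2 ^+ n].
  elim: k => [|k [i1 i2 i3 i4]]; first by rewrite addn0 !lexx.
  rewrite addnS; have [/andP[j1 j2] /andP[j3 j4] _] := Hf ((n + k)%N, s (n + k)%N) (bads _).
  move: i2 i4; rewrite (half w (n + k)%N) (half h (n + k)%N) /= in j1 j2 j3 j4 *.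
  by move=> i2 i4; split; lra.
have wn n : 0 <= w / 2 ^+ n by rewrite divr_ge0 // exprn_ge0.
have hn n : 0 <= h / 2 ^+ n by rewrite divr_ge0 // exprn_ge0.
have le1 m n : (s m).1 <= (s n).1 + w / 2 ^+ n.
  have [mn|/ltnW nm] := leqP m n.
    by have [i _ _ _] := nest m (n - m)%N; rewrite subnKC // in i; have := wn n; lra.
  by have [_ i _ _] := nest n (m - n)%N; rewrite subnKC // in i; have := wn m; lra.
have le2 m n : (s m).2 <= (s n).2 + h / 2 ^+ n.
  have [mn|/ltnW nm] := leqP m n.
    by have [_ _ i _] := nest m (n - m)%N; rewrite subnKC // in i; have := hn n; lra.
  by have [_ _ _ i] := nest n (m - n)%N; rewrite subnKC // in i; have := hn m; lra.
exists (sup (range (fun n => (s n).1))), (sup (range (fun n => (s n).2))) => n.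
have ne1 : (range (fun n => (s n).1)) !=set0 by exists (s 0%N).1, 0%N.
have ne2 : (range (fun n => (s n).2)) !=set0 by exists (s 0%N).2, 0%N.
exists (s n).1, (s n).2; split => //; apply/andP; split.
- apply: ub_le_sup; last by exists n.
  by exists ((s 0%N).1 + w / 2 ^+ 0) => _ [m _ <-].
- by apply: ge_sup => // _ [m _ <-].
- apply: ub_le_sup; last by exists n.
  by exists ((s 0%N).2 + h / 2 ^+ 0) => _ [m _ <-].
- by apply: ge_sup => // _ [m _ <-].
Qed.

(* [H x y] stands for a function of [x + i y], with complex derivative [A]. *)
Definition cdiff2 (H : R -> R -> R[i]) x y (A : R[i]) := forall e : R, 0 < e ->
  exists2 dl : R, 0 < dl & forall u v, `|u| < dl -> `|v| < dl ->
    normc (H (x + u) (y + v) - H x y - A * (u +i* v)) <= e * (`|u| + `|v|).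

Lemma Im_le_normc (z : R[i]) : Im z <= normc z.
Proof.
have -> : Im z = Re (- 'i%C * z) by case: z => x y; simpc => /=.
by apply: le_trans (Re_le_normc _) _; rewrite normcM normcN /= expr0n expr1n add0r sqrtr1 mul1r.
Qed.

Lemma normc_continuous_Re_Im (k : R -> R[i]) x (K dl : R) : 0 < dl -> 0 < K ->
  (forall u, `|u| < dl -> normc (k (x + u) - k x) <= K * `|u|) ->
  {for x, continuous (fun x => Re (k x))} /\ {for x, continuous (fun x => Im (k x))}.
Proof.
move=> d0 K0 H.
have abs_le (z : R[i]) : `|Re z| <= normc z /\ `|Im z| <= normc z.
  have := Re_le_normc (- z); have := Im_le_normc (- z); rewrite normcN !raddfN.
  have := Re_le_normc z; have := Im_le_normc z.
  by rewrite !ler_norml; split; apply/andP; split; lra.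
split; apply/cvgrPdist_lt => /= e e0; near=> t.
- have td : `|t - x| < Num.min dl (e / K).
    rewrite distrC; near: t; apply: cvgr_dist_lt => //.
    by rewrite lt_min d0 divr_gt0.
  move: td; rewrite lt_min => /andP[/H h td].
  rewrite (_ : x + (t - x) = t) in h; last by ring.
  rewrite distrC -raddfB; apply: le_lt_trans (abs_le _).1 _; apply: le_lt_trans h _.
  by rewrite mulrC -ltr_pdivlMr.
- have td : `|t - x| < Num.min dl (e / K).
    rewrite distrC; near: t; apply: cvgr_dist_lt => //.
    by rewrite lt_min d0 divr_gt0.
  move: td; rewrite lt_min => /andP[/H h td].
  rewrite (_ : x + (t - x) = t) in h; last by ring.
  rewrite distrC -raddfB; apply: le_lt_trans (abs_le _).2 _; apply: le_lt_trans h _.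
  by rewrite mulrC -ltr_pdivlMr.
Unshelve. all: by end_near. Qed.

Lemma normc_re (x : R) : normc (x +i* 0) = `|x|. Proof. exact: normc_real. Qed.

Lemma normc_im (x : R) : normc (0 +i* x) = `|x|.
Proof. by rewrite /= expr0n add0r sqrtr_sqr. Qed.

Lemma cdiff2_continuous_x H x y A : cdiff2 H x y A ->
  {for x, continuous (fun x => Re (H x y))} /\ {for x, continuous (fun x => Im (H x y))}.
Proof.
move=> /(_ 1 ltr01)[dl d0 h]; have A0 := normc_ge0 A.
apply: (@normc_continuous_Re_Im (H^~ y) x (normc A + 1) dl) => //; first by lra.
move=> u ud; have := h u 0 ud; rewrite normr0 addr0 addr0 => /(_ d0).
have := le_normcD (H (x + u) y - H x y - A * (u +i* 0)) (A * (u +i* 0)).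
by rewrite subrK normcM normc_re; lra.
Qed.

Lemma cdiff2_continuous_y H x y A : cdiff2 H x y A ->
  {for y, continuous (fun y => Re (H x y))} /\ {for y, continuous (fun y => Im (H x y))}.
Proof.
move=> /(_ 1 ltr01)[dl d0 h]; have A0 := normc_ge0 A.
apply: (@normc_continuous_Re_Im (H x) y (normc A + 1) dl) => //; first by lra.
move=> u ud; have := h 0 u; rewrite normr0 add0r addr0 => /(_ d0 ud).
have := le_normcD (H x (y + u) - H x y - A * (0 +i* u)) (A * (0 +i* u)).
by rewrite subrK normcM normc_im; lra.
Qed.

End Primitives.

Section Goursat.
Variables (R : realType) (H P Q : R -> R -> R[i]) (a0 b0 c0 d0 : R).
Hypothesis Pprim : forall y, cprim (P y) (H^~ y) a0 b0.
Hypothesis Qprim : forall x, a0 < x < b0 -> cprim (Q x) (H x) c0 d0.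

(* As [P y] and [Q x] are primitives along horizontal and vertical lines, this is
   the integral of [H] over the boundary of [a, b] x [c, d]. *)
Definition contour a b c d : R[i] :=
  (P c b - P c a) - (P d b - P d a) +
  'i%C * ((Q b d - Q b c) - (Q a d - Q a c)).

(** The affine approximation of [H] has zero integral around the rectangle. What remains is its
    error, at most [e] times the half-perimeter, integrated over the four sides. *)
Lemma contour_estimate a b c d p q A e :
  a0 < a -> b < b0 -> c0 < c -> d < d0 -> a <= p <= b -> c <= q <= d -> 0 <= e ->
  (forall x y, a <= x <= b -> c <= y <= d ->
     normc (H x y - H p q - A * ((x - p) +i* (y - q))) <= e * (`|x - p| + `|y - q|)) ->
  normc (contour a b c d) <= 2 * e * ((b - a) + (d - c)) ^+ 2.
Proof.
move=> a0a bb0 c0c dd0 /andP[ap pb] /andP[cq qd] e0 est.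
have ab : a <= b by lra. have cd : c <= d by lra.
set L := (b - a) + (d - c).
have est' x y : a <= x <= b -> c <= y <= d ->
    normc (H x y - H p q - A * ((x - p) +i* (y - q))) <= e * L.
  move=> xab ycd; apply: le_trans (est x y xab ycd) _; rewrite ler_wpM2l //.
  move: xab ycd => /andP[? ?] /andP[? ?]; apply: lerD; rewrite ler_norml; apply/andP; split; lra.
have complexE2 (x y : R) : x +i* y = x%:C + 'i%C * y%:C :> R[i] by simpc.
have ii : 'i%C * 'i%C = -1 :> R[i] by rewrite -expr2 sqr_i.
(* The affine approximation is [bh y + A x] along a horizontal line and [bv x + 'i A y] along a
   vertical one; both have quadratic primitives. *)
pose bh y := H p q + A * ('i%C * (y - q)%:C - p%:C).
pose bv x := H p q + A * ((x - p)%:C - 'i%C * q%:C).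
have hor y : c <= y <= d -> normc (P y b - P y a -
    (bh y * (b - a)%:C + A / 2 * (b ^+ 2 - a ^+ 2)%:C)) <= e * L * (b - a).
  move=> ycd; have := @cprim_mean_value _ _ _ a0 b0 a b (e * L)
    (cprimB (@Pprim y) (@cprim_quadratic _ (bh y) (A / 2) a0 b0)) a0a ab bb0.
  have -> : P y b - (bh y * b%:C + A / 2 * (b ^+ 2)%:C) -
     (P y a - (bh y * a%:C + A / 2 * (a ^+ 2)%:C)) = P y b - P y a -
     (bh y * (b - a)%:C + A / 2 * (b ^+ 2 - a ^+ 2)%:C) by rewrite !rmorphB; ring.
  apply=> x xab; have := est' x y xab ycd.
  rewrite complexE2 /bh; congr (normc _ <= _).
  by rewrite (rmorphM (real_complex R) 2) rmorph_nat !rmorphB; field.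
have ver x : a <= x <= b -> normc (Q x d - Q x c -
    (bv x * (d - c)%:C + 'i%C * A / 2 * (d ^+ 2 - c ^+ 2)%:C)) <= e * L * (d - c).
  move=> xab; have xab0 : a0 < x < b0.
    by case/andP: xab => ? ?; apply/andP; split; lra.
  have := @cprim_mean_value _ _ _ c0 d0 c d (e * L)
    (cprimB (Qprim xab0) (@cprim_quadratic _ (bv x) ('i%C * A / 2) c0 d0)) c0c cd dd0.
  have -> : Q x d - (bv x * d%:C + 'i%C * A / 2 * (d ^+ 2)%:C) -
     (Q x c - (bv x * c%:C + 'i%C * A / 2 * (c ^+ 2)%:C)) = Q x d - Q x c -
     (bv x * (d - c)%:C + 'i%C * A / 2 * (d ^+ 2 - c ^+ 2)%:C) by rewrite !rmorphB; ring.
  apply=> y ycd; have := est' x y xab ycd.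
  rewrite complexE2 /bv; congr (normc _ <= _).
  by rewrite (rmorphM (real_complex R) 2) rmorph_nat !rmorphB; field.
have hc : c <= c <= d by rewrite lexx. have hd : c <= d <= d by rewrite lexx andbT.
have ha : a <= a <= b by rewrite lexx. have hb : a <= b <= b by rewrite lexx andbT.
have := hor _ hc; have := hor _ hd; have := ver _ ha; have := ver _ hb.
set z1 := _ - (_ + _); set z2 := _ - (_ + _); set z3 := _ - (_ + _).
set z4 := _ - (_ + _); move=> h1 h2 h3 h4.
(* The quadratic primitives cancel around the rectangle because of ['i * 'i = -1]. *)
have -> : contour a b c d = (z4 - z3) + 'i%C * (z1 - z2).
  rewrite /contour /z1 /z2 /z3 /z4 /bh /bv !rmorphB; ring: ii.
apply: le_trans (le_normcD _ _) _; rewrite normcM normc_im normr1 mul1r.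
have := le_normcD z4 (- z3); have := le_normcD z1 (- z2); rewrite !normcN.
have -> : 2 * e * L ^+ 2 = 2 * (e * L * (b - a)) + 2 * (e * L * (d - c)).
  by rewrite /L; ring.
lra.
Qed.

Lemma goursat a b c d : a0 < a -> a < b -> b < b0 -> c0 < c -> c < d -> d < d0 ->
  (forall x y, a <= x <= b -> c <= y <= d -> exists A, cdiff2 H x y A) ->
  contour a b c d = 0.
Proof.
move=> a0a ab bb0 c0c cd dd0 Hd; apply: contrapT => /eqP; rewrite -normc_gt0.
set J0 := normc _ => J0p; set w := b - a; set h := d - c.
have w0 : 0 < w by rewrite subr_gt0. have h0 : 0 < h by rewrite subr_gt0.
pose J x y n := contour x (x + w / 2 ^+ n) y (y + h / 2 ^+ n).
pose bad x y n := [/\ a <= x, x + w / 2 ^+ n <= b, c <= y, y + h / 2 ^+ n <= d &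
  J0 / 4 ^+ n <= normc (J x y n)].
have half (t : R) n : t / 2 ^+ n = t / 2 ^+ n.+1 + t / 2 ^+ n.+1.
  by rewrite exprS; field; rewrite expf_neq0.
have wn n : 0 < w / 2 ^+ n by rewrite divr_gt0 // exprn_gt0.
have hn n : 0 < h / 2 ^+ n by rewrite divr_gt0 // exprn_gt0.
have step n x y : bad x y n -> exists x' y',
    [/\ x <= x' <= x + w / 2 ^+ n.+1, y <= y' <= y + h / 2 ^+ n.+1 & bad x' y' n.+1].
  move=> [i1 i2 i3 i4 i5].
  have := wn n.+1; have := hn n.+1; set w' := w / 2 ^+ n.+1; set h' := h / 2 ^+ n.+1.
  rewrite (half w) -/w' in i2; rewrite (half h) -/h' in i4.
  move=> h'0 w'0.
  have dec : J x y n = J x y n.+1 + J (x + w') y n.+1 +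
      (J x (y + h') n.+1 + J (x + w') (y + h') n.+1).
    rewrite /J (half w n) (half h n) -/w' -/h' /contour !addrA; ring.
  pose m := J0 / 4 ^+ n.+1.
  have mE : J0 / 4 ^+ n = 4 * m by rewrite /m exprS; field; rewrite expf_neq0.
  have : 4 * m <= normc (J x y n.+1) + normc (J (x + w') y n.+1) +
     (normc (J x (y + h') n.+1) + normc (J (x + w') (y + h') n.+1)).
    rewrite -mE; apply: le_trans i5 _; rewrite dec.
    apply: le_trans (le_normcD _ _) _.
    by apply: lerD; exact: le_normcD.
  have mk x' y' : x <= x' -> x' <= x + w' -> y <= y' -> y' <= y + h' ->
      m <= normc (J x' y' n.+1) -> exists x' y',
      [/\ x <= x' <= x + w', y <= y' <= y + h' & bad x' y' n.+1].
    move=> k1 k2 k3 k4 k5; exists x', y'; rewrite k1 k2 k3 k4; split => //.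
    by split => //; rewrite -?/w' -?/h'; lra.
  case: (leP m (normc (J x y n.+1))) => k1; first by move=> _; apply: mk k1; lra.
  case: (leP m (normc (J (x + w') y n.+1))) => k2.
    by move=> _; apply: mk k2; lra.
  case: (leP m (normc (J x (y + h') n.+1))) => k3.
    by move=> _; apply: mk k3; lra.
  by move=> k4; apply: (mk (x + w') (y + h')); lra.
have bad0 : bad a c 0%N.
  by split; rewrite ?lexx // /J ?expr0 ?divr1 /w /h 2?[_ + (_ - _)]addrC ?subrK.
have [p [q pq]] := bisection (ltW w0) (ltW h0) step bad0.
have [x0 [y0 [[i1 i2 i3 i4 _] /andP[i5 i6] /andP[i7 i8]]]] := pq 0%N.
have pab : a <= p <= b by apply/andP; split; lra.
have qcd : c <= q <= d by apply/andP; split; lra.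
have [A HA] := Hd p q pab qcd.
have S0 : 0 < (w + h) ^+ 2 by rewrite exprn_gt0 // addr_gt0.
(* With this tolerance [contour_estimate] gives half of the lower bound [J0 / 4 ^+ n]. *)
pose e := J0 / (4 * (w + h) ^+ 2).
have e0 : 0 < e by rewrite divr_gt0 // mulr_gt0.
have [dl dl0 Hdl] := HA _ e0.
have [n Hn] : exists n, (w + h) / 2 ^+ n < dl.
  have := @cvg_geometric R (w + h) (2^-1); rewrite ger0_norm ?invr_ge0 // invf_lt1 // ltr1n.
  move=> /(_ isT)/cvgrPdist_lt/(_ _ dl0)[n _ /(_ n (leqnn n))] /=.
  rewrite sub0r normrN /geometric /= exprVn => hh; exists n.
  exact: le_lt_trans (ler_norm _) hh.
have [x [y [[j1 j2 j3 j4 j5] /andP[j6 j7] /andP[j8 j9]]]] := pq n.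
have wnn := wn n; have hnn := hn n; rewrite mulrDl in Hn.
have est : normc (J x y n) <= 2 * e * ((w + h) / 2 ^+ n) ^+ 2.
  have -> : (w + h) / 2 ^+ n = x + w / 2 ^+ n - x + (y + h / 2 ^+ n - y) by ring.
  apply: (@contour_estimate _ _ _ _ p q A e);
    [lra|lra|lra|lra|by rewrite j6|by rewrite j8|exact: ltW|].
  move=> x1 y1 /andP[x1a x1b] /andP[y1a y1b].
  have := Hdl (x1 - p) (y1 - q).
  rewrite (_ : p + (x1 - p) = x1); last by ring.
  rewrite (_ : q + (y1 - q) = y1); last by ring.
  by apply; rewrite ltr_norml; apply/andP; split; lra.
move: est => /(le_trans j5); apply/negP; rewrite -ltNge.
rewrite expr_div_n -exprM mulnC exprM (_ : 2 ^+ 2 = 4 :> R); last by rewrite -natrX.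
rewrite mulrA ltr_pM2r ?invr_gt0 ?exprn_gt0 // /e.
have -> : 2 * (J0 / (4 * (w + h) ^+ 2)) * (w + h) ^+ 2 = J0 / 2.
  by field; rewrite lt0r_neq0 // addr_gt0.
lra.
Qed.

End Goursat.

(** * The Schwarz lemma and disk automorphisms *)

Section Polar.
Variable R : realType.
Implicit Types (x y u v : R) (z : R[i]).

Lemma is_derive_expand (f : R -> R) x d : is_derive x 1 f d ->
  forall e : R, 0 < e -> exists2 dl : R, 0 < dl &
    forall u, `|u| < dl -> `|f (x + u) - f x - d * u| <= e * `|u|.
Proof.
move=> [/cvgrPdist_le /= H dE] e e0.
have := H e e0; rewrite -/('D_1 f x) dE => /nbhs_ballP[dl dl0 Hd].
exists dl => // u ud; have [->|u0] := eqVneq u 0.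
  by rewrite addr0 subrr mulr0 subr0 normr0 mulr0.
have := Hd u; rewrite /ball /= sub0r normrN => /(_ ud u0).
have -> : d - u^-1 *: (f (u *: 1 + x) - f x) = - ((f (x + u) - f x - d * u) / u).
  rewrite /GRing.scale /= mulr1 [u + x]addrC mulrBl mulfK // opprB.
  by rewrite [u^-1 * _]mulrC.
by rewrite normrN normrM normfV ler_pdivrMr ?normr_gt0.
Qed.

Lemma expand_is_derive (f : R -> R) x d :
  (forall e : R, 0 < e -> exists2 dl : R, 0 < dl &
    forall u, `|u| < dl -> `|f (x + u) - f x - d * u| <= e * `|u|) ->
  is_derive x 1 f d.
Proof.
move=> H; have cv : (fun h : R => h^-1 *: (f (h *: (1 : R) + x) - f x)) @ 0^' --> d.
  apply/cvgrPdist_le => /= e e0; have [dl dl0 Hd] := H e e0.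
  near=> u.
  have u0 : u != 0 by near: u; exact: nbhs_dnbhs_neq.
  have ud : `|u| < dl by near: u; apply: dnbhs0_lt.
  have -> : d - u^-1 *: (f (u *: 1 + x) - f x) = - ((f (x + u) - f x - d * u) / u).
    rewrite /GRing.scale /= mulr1 [u + x]addrC mulrBl mulfK // opprB.
    by rewrite [u^-1 * _]mulrC.
  by rewrite normrN normrM normfV ler_pdivrMr ?normr_gt0 // Hd.
apply: DeriveDef; first by apply: (cvgP d); exact: cv.
by apply: cvg_lim => //; exact: cv.
Unshelve. all: by end_near. Qed.

(** The complex exponential of [x + i y]: the unit disk without its center corresponds to [x < 0],
    and a height of [2 pi] to a full turn. *)
Definition polar x y : R[i] := (expR x)%:C * (cos y +i* sin y).

Lemma normc_cis y : normc (cos y +i* sin y) = 1.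
Proof. by rewrite /= cos2Dsin2 sqrtr1. Qed.

Lemma normc_polar x y : normc (polar x y) = expR x.
Proof. by rewrite normcM normc_cis mulr1 normc_realp // expR_ge0. Qed.

Lemma polarD x y u v : polar (x + u) (y + v) = polar x y * polar u v.
Proof.
rewrite /polar expRD cosD sinD rmorphM mulrACA; congr (_ * _).
by simpc => /=; rewrite [sin y * cos v + _]addrC.
Qed.

Lemma normc_le_abs u v : normc (u +i* v) <= `|u| + `|v|.
Proof.
have -> : u +i* v = (u +i* 0) + (0 +i* v) by simpc.
by apply: le_trans (le_normcD _ _) _; rewrite normc_re normc_im.
Qed.

(** The derivative at the origin is enough, since [polarD] carries it to every other point. *)
Lemma polar_expand (e : R) : 0 < e -> exists2 dl : R, 0 < dl &
  forall u v, `|u| < dl -> `|v| < dl ->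
    normc (polar u v - 1 - (u +i* v)) <= e * (`|u| + `|v|).
Proof.
move=> e0; have e8 : 0 < e / 8 by rewrite divr_gt0.
have [d1 d10 H1] := is_derive_expand (is_derive_expR 0) e8.
have [d2 d20 H2] := is_derive_expand (is_derive_cos 0) e8.
have [d3 d30 H3] := is_derive_expand (is_derive_sin 0) e8.
exists (Num.min (Num.min d1 d2) (Num.min d3 (Num.min 1 (e / 4)))).
  by rewrite !lt_min d10 d20 d30 ltr01 divr_gt0.
move=> u v; rewrite !lt_min.
move=> /andP[/andP[/H1 h1 _] /andP[_ /andP[u1 ue]]].
move=> /andP[/andP[_ /H2 h2] /andP[/H3 h3 _]].
move: h1 h2 h3; rewrite !add0r expR0 cos0 sin0 oppr0 mul0r !subr0 ?addr0 !mul1r => h1 h2 h3.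
have -> : polar u v - 1 - (u +i* v) =
   (expR u - 1 - u)%:C * (cos v +i* sin v) +
   ((1 + u)%:C * ((cos v - 1) +i* (sin v - v)) + 0 +i* (u * v)).
  by rewrite /polar; simpc; apply/eqP; rewrite eq_complex /=; apply/andP; split; apply/eqP; ring.
have n1 : normc ((expR u - 1 - u)%:C * (cos v +i* sin v)) <= e / 8 * `|u|.
  by rewrite normcM normc_cis mulr1 normc_real.
have n2 : normc ((1 + u)%:C * ((cos v - 1) +i* (sin v - v))) <= 2 * (e / 8 * `|v| + e / 8 * `|v|).
  rewrite normcM normc_real; apply: ler_pM; rewrite ?normr_ge0 ?normc_ge0 //.
    by apply: le_trans (ler_normD _ _) _; rewrite normr1; lra.
  by apply: le_trans (normc_le_abs _ _) _; exact: lerD.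
have n3 : normc (0 +i* (u * v)) <= e / 4 * `|v|.
  by rewrite normc_im normrM ler_wpM2r // ltW.
apply: le_trans (le_normcD _ _) _.
have := le_normcD ((1 + u)%:C * ((cos v - 1) +i* (sin v - v))) (0 +i* (u * v)).
have u0 := mulr_ge0 (ltW e0) (normr_ge0 u); have v0 := mulr_ge0 (ltW e0) (normr_ge0 v).
lra.
Qed.

Lemma cdiff2_polar (g : R[i] -> R[i]) x y A : cdiff g (polar x y) A ->
  cdiff2 (fun x y => g (polar x y)) x y (A * polar x y).
Proof.
move=> gA e e0; set E := polar x y.
have E0 : 0 < normc E by rewrite normc_polar expR_gt0.
have A0 := normc_ge0 A.
have [d1 d10 H1] := gA (e / 4 / normc E) (divr_gt0 (divr_gt0 e0 (ltr0n _ 4)) E0).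
have e2 : 0 < e / 2 / (normc A * normc E + 1).
  by rewrite !divr_gt0 // ltr_wpDl // mulr_ge0 // ltW.
have [d2 d20 H2] := polar_expand e2.
have [d3 d30 H3] := polar_expand (@ltr01 R).
exists (Num.min (Num.min d2 d3) (d1 / 4 / normc E)).
  by rewrite !lt_min d20 d30 !divr_gt0.
move=> u v; rewrite !lt_min => /andP[/andP[u2 u3] u1] /andP[/andP[v2 v3] v1].
have {}H2 := H2 _ _ u2 v2; have {}H3 := H3 _ _ u3 v3.
set S := `|u| + `|v| in H2 H3 *; have S0 : 0 <= S by rewrite addr_ge0.
have S2 : normc E * (2 * S) < d1.
  have q0 : 0 < d1 / normc E by rewrite divr_gt0.
  rewrite mulrAC in u1 v1; rewrite mulrC -ltr_pdivlMr // /S; lra.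
rewrite polarD -/E; set k := E * polar u v - E.
have kE : k = E * (polar u v - 1) by rewrite /k; ring.
have P1 : normc (polar u v - 1) <= 2 * S.
  have := le_normcD (polar u v - 1 - (u +i* v)) (u +i* v); rewrite subrK.
  by have := normc_le_abs u v; rewrite -/S; lra.
have k1 : normc k <= normc E * (2 * S) by rewrite kE normcM ler_wpM2l // ltW.
have := H1 k (le_lt_trans k1 S2).
rewrite (_ : E + k = E * polar u v) /k; last by ring.
rewrite -/k => h1.
have -> : g (E * polar u v) - g E - A * E * (u +i* v) =
  (g (E * polar u v) - g E - A * k) + A * E * (polar u v - 1 - (u +i* v)).
  by rewrite kE; ring.
apply: le_trans (le_normcD _ _) _; rewrite normcM normcM.
have b1 : normc (g (E * polar u v) - g E - A * k) <= e / 2 * S.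
  apply: le_trans h1 _; apply: le_trans (ler_wpM2l _ k1) _.
    by rewrite !divr_ge0 // ltW.
  by rewrite mulrA divfK ?lt0r_neq0 //; lra.
have b2 : normc A * normc E * normc (polar u v - 1 - (u +i* v)) <= e / 2 * S.
  apply: le_trans (ler_wpM2l _ H2) _; first by rewrite mulr_ge0 // ltW.
  rewrite mulrA ler_wpM2r // mulrC ler_divMl_add1 ?divr_ge0 ?mulr_ge0 //; exact: ltW.
lra.
Qed.

Lemma cdiff_affine (p q : R[i]) z : cdiff (fun w => p + q * w) z q.
Proof.
move=> e e0; exists 1 => // h _; rewrite (_ : _ - _ = 0); last by ring.
by rewrite normc0 mulr_ge0 ?normc_ge0 // ltW.
Qed.

Lemma cdiffV z : z != 0 -> cdiff (fun w => w^-1) z (- z ^- 2).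
Proof.
move=> z0 e e0; have n0 : 0 < normc z by rewrite normc_gt0.
pose K := 2 / normc z ^+ 3.
have K0 : 0 < K by rewrite divr_gt0 // exprn_gt0.
exists (Num.min (normc z / 2) (e / K)); first by rewrite lt_min (divr_gt0 n0) // divr_gt0.
move=> h; rewrite lt_min => /andP[h2 hK]; have h0 := normc_ge0 h.
have zh : normc z / 2 <= normc (z + h).
  by have := normcB_ge z (- h); rewrite normcN opprK; lra.
have zh0 : z + h != 0 by rewrite -normc_gt0; lra.
have -> : (z + h)^-1 - z^-1 - - z ^- 2 * h = h / (z ^+ 2 * (z + h)) * h.
  by field; rewrite z0 zh0.
rewrite normcM ler_wpM2r // normcM normcV normcM expr2 normcM -expr2.
have : normc h * K <= e by rewrite -ler_pdivlMr // ltW.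
apply: le_trans; rewrite ler_wpM2l // /K.
have -> : 2 / normc z ^+ 3 = (normc z ^+ 2 * (normc z / 2))^-1.
  by field; rewrite lt0r_neq0.
rewrite lef_pV2 ?posrE ?mulr_gt0 ?exprn_gt0 ?divr_gt0 //; last by lra.
by rewrite ler_wpM2l // exprn_ge0 // ltW.
Qed.

Lemma cprim_eq (G G' k : R -> R[i]) a0 b0 a b : cprim G k a0 b0 ->
  cprim G' k a0 b0 -> a0 < a -> a <= b -> b < b0 -> G b - G a = G' b - G' a.
Proof.
move=> Gk G'k a0a ab bb0.
have := cprim_mean_value (cprimB Gk G'k) a0a ab bb0 (M := 0).
rewrite mul0r => /(_ _)/wrap[x _|]; first by rewrite subrr normc0.
move=> h; apply/eqP; rewrite -subr_eq0 -normc_eq0 eq_le normc_ge0 andbT.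
by apply: le_trans h; rewrite le_eqVlt; apply/orP; left; apply/eqP; congr normc; ring.
Qed.

(* The mean of f(z)/z over |z| = r does not depend on r by Goursat; it tends to
   f'(0) as r -> 0 and is at most 1/r in modulus. *)
Lemma schwarz_derivative (f : R[i] -> R[i]) A :
  (forall z, normc z < 1 -> normc (f z) <= 1) ->
  (forall z, normc z < 1 -> exists B, cdiff f z B) ->
  f 0 = 0 -> cdiff f 0 A -> normc A <= 1.
Proof.
move=> f1 fd f0 fA; pose g z := f z * z^-1.
pose H x y := g (polar x y).
have Hd x y : x < 0 -> exists B, cdiff2 H x y B.
  move=> x0; have z0 : polar x y != 0 by rewrite -normc_gt0 normc_polar expR_gt0.
  have [|B fB] := fd (polar x y); first by rewrite normc_polar expR_lt1.
  by eexists; apply: cdiff2_polar; apply: cdiffM fB (cdiffV z0).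
have p0 : 0 < (pi : R) *+ 2 by rewrite mulrn_wgt0 // pi_gt0.
have Hper x : H x 0 = H x (pi *+ 2).
  by rewrite /H /polar cos0 sin0 cos2pi sin2pi.
apply/ler_addgt0Pl => t t0; have t2 : 0 < t / 2 by rewrite divr_gt0.
have t21 : 0 < 1 + t / 2 by lra.
(* The logarithm of the outer radius [1 / (1 + t / 2)]; on that circle [|f(z) / z| <= 1 + t / 2]. *)
pose x2 := - ln (1 + t / 2).
have ex2 : expR x2 = (1 + t / 2)^-1 by rewrite expRN lnK.
have x20 : x2 < 0 by rewrite -expR_lt1 ex2 invf_lt1 //; lra.
have [dl dl0 Hdl] := fA _ t2.
(* The logarithm of an inner radius below [dl], where [f(z) / z] is within [t / 2] of [A]. *)
pose x1 := Num.min (x2 - 1) (ln dl - 1).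
have x12 : x1 < x2.
  by apply: (@le_lt_trans _ _ (x2 - 1)); [rewrite ge_min lexx|lra].
have ex1 : expR x1 < dl.
  rewrite -[ltRHS](lnK dl0) ltr_expR.
  by apply: (@le_lt_trans _ _ (ln dl - 1)); [rewrite ge_min lexx orbT|lra].
(* Primitives are taken on a wider interval than the rectangle; its right end [x2 / 2] is still
   negative. *)
have /choice[P HP] : forall y : R, exists Py : R -> R[i],
    cprim Py (H^~ y) (x1 - 1) (x2 / 2).
  move=> y; apply: exists_cprim; first by lra.
    by move=> x /andP[? ?]; have [|B /cdiff2_continuous_x[]//] := Hd x y; lra.
  by move=> x /andP[? ?]; have [|B /cdiff2_continuous_x[]//] := Hd x y; lra.
have /choice[Q HQ] : forall x : R, exists Qx : R -> R[i], x < 0 ->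
    cprim Qx (H x) (-1) (pi *+ 2 + 1).
  move=> x; case: (ltP x 0) => x0; last by exists (H x).
  have [|||Qx HQx] := @exists_cprim _ (H x) (-1) (pi *+ 2 + 1); first by lra.
  - by move=> y _; have [B /cdiff2_continuous_y[]//] := Hd x y x0.
  - by move=> y _; have [B /cdiff2_continuous_y[]//] := Hd x y x0.
  by exists Qx.
have HQ' x : x1 - 1 < x < x2 / 2 -> cprim (Q x) (H x) (-1) (pi *+ 2 + 1).
  by move=> /andP[_ ?]; apply: HQ; lra.
have := @goursat _ H P Q (x1 - 1) (x2 / 2) (-1) (pi *+ 2 + 1) HP HQ' x1 x2 0 (pi *+ 2).
move=> gs; have {gs} : contour P Q x1 x2 0 (pi *+ 2) = 0.
  by apply: gs; [lra|lra|lra|lra|lra|lra|move=> x y /andP[_ ?] _; apply: Hd; lra].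
(* By periodicity the two horizontal sides cancel, which leaves the equality of the two circle
   integrals. *)
have per : P 0 x2 - P 0 x1 = P (pi *+ 2) x2 - P (pi *+ 2) x1.
  apply: (@cprim_eq _ _ (H^~ 0) (x1 - 1) (x2 / 2)); [exact: HP| |lra|lra|lra].
  by rewrite (_ : H^~ 0 = H^~ (pi *+ 2)); [exact: HP|apply/funext => x; exact: Hper].
rewrite /contour per subrr add0r => /eqP; rewrite mulf_eq0.
have -> : ('i%C == 0 :> R[i]) = false by rewrite eq_complex /= oner_eq0 andbF.
rewrite subr_eq0 => /= /eqP I12.
have B2 : normc (Q x2 (pi *+ 2) - Q x2 0) <= (1 + t / 2) * (pi *+ 2 - 0).
  apply: (cprim_mean_value (HQ _ x20)); [lra|exact: ltW|lra|].
  move=> y _; rewrite /H /g normcM normcV normc_polar ex2 invrK.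
  by rewrite ler_piMl ?(ltW t21) // f1 // normc_polar expR_lt1.
have x10 : x1 < 0 by lra.
have B1 : normc ((Q x1 (pi *+ 2) - (0 + A * (pi *+ 2)%:C)) - (Q x1 0 - (0 + A * 0%:C)))
    <= t / 2 * (pi *+ 2 - 0).
  have CA : cprim (fun y => 0 + A * y%:C) (fun=> A) (-1) (pi *+ 2 + 1).
    have := @cprim_quadratic R A 0 (-1) (pi *+ 2 + 1).
    rewrite (_ : (fun x => A + 0 * _) = fun=> A); last by apply/funext => y; ring.
    by rewrite (_ : (fun x => _) = fun y => 0 + A * y%:C) //; apply/funext => y; ring.
  apply: (cprim_mean_value (cprimB (HQ _ x10) CA)); [lra|exact: ltW|lra|].
  move=> y _; have z0 : polar x1 y != 0 by rewrite -normc_gt0 normc_polar expR_gt0.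
  have := Hdl (polar x1 y); rewrite add0r f0 subr0 normc_polar => /(_ ex1).
  have -> : H x1 y - A = (f (polar x1 y) - A * polar x1 y) / polar x1 y.
    by rewrite /H /g; field.
  by rewrite normcM normcV normc_polar ler_pdivrMr // expR_gt0.
rewrite subr0 in B1 B2.
have : normc (A * (pi *+ 2)%:C) <= (1 + t / 2) * (pi *+ 2) + t / 2 * (pi *+ 2).
  have -> : A * (pi *+ 2)%:C = (Q x2 (pi *+ 2) - Q x2 0) -
    ((Q x1 (pi *+ 2) - (0 + A * (pi *+ 2)%:C)) - (Q x1 0 - (0 + A * 0%:C))).
    by rewrite I12 rmorph0; ring.
  apply: le_trans (le_normcD _ _) _; rewrite normcN; exact: lerD.
rewrite normcM normc_realp ?(ltW p0) // -mulrDl ler_pM2r //; lra.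
Qed.

End Polar.

(** * Schwarz-Pick and the form of disk automorphisms *)

Section DiskAutomorphisms.
Variable R : realType.
Implicit Types (b z w : R[i]).

Definition mob b z : R[i] := (z - b) / (1 - b^* * z).

Lemma mob_den b z : normc b < 1 -> normc z < 1 -> 1 - b^* * z != 0.
Proof.
by move=> b1 z1; rewrite one_sub_neq0 // normc_conj mulr_ilt1 ?normc_ge0.
Qed.

Lemma normc_mob b z : normc (mob b z) = normc (z - b) / normc (1 - b^* * z).
Proof. by rewrite /mob normcM normcV. Qed.

Lemma mob_identity b z : normc b < 1 -> normc z < 1 ->
  1 - normc (mob b z) ^+ 2 =
  (1 - normc b ^+ 2) * (1 - normc z ^+ 2) / normc (1 - b^* * z) ^+ 2.
Proof.
move=> b1 z1; have := mob_den b1 z1; rewrite -normc_gt0 => n0.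
rewrite normc_mob expr_div_n.
apply: (mulIf (lt0r_neq0 (exprn_gt0 2 n0))).
rewrite mulrBl mul1r !divfK ?expf_neq0 ?lt0r_neq0 // !sqr_normcE.
by case: b z {b1 z1 n0} => [a b] [x y] /=; simpc => /=; ring.
Qed.

Lemma mob_lt1 b z : normc b < 1 -> normc z < 1 -> normc (mob b z) < 1.
Proof.
move=> b1 z1; have n0 := mob_den b1 z1.
have lt1 w : normc w < 1 -> 0 < 1 - normc w ^+ 2.
  by move=> w1; rewrite subr_gt0 expr_lt1 ?normc_ge0.
have : 0 < 1 - normc (mob b z) ^+ 2.
  by rewrite mob_identity // divr_gt0 ?mulr_gt0 ?exprn_gt0 ?lt1 ?normc_gt0.
by rewrite subr_gt0 expr_lt1 ?normc_ge0.
Qed.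

Lemma mob0 b : mob b 0 = - b. Proof. by rewrite /mob mulr0 subr0 divr1 sub0r. Qed.

Lemma mobb b : mob b b = 0. Proof. by rewrite /mob subrr mul0r. Qed.

Lemma conjcN (z : R[i]) : (- z)^* = - z^*. Proof. exact: rmorphN. Qed.

Lemma one_sub_norm_neq0 b : normc b < 1 -> 1 - b^* * b != 0.
Proof. by move=> b1; exact: mob_den. Qed.

Lemma mobK b z : normc b < 1 -> normc z < 1 -> mob (- b) (mob b z) = z.
Proof.
move=> b1 z1; have n0 := mob_den b1 z1; have n1 := one_sub_norm_neq0 b1.
rewrite /mob conjcN; move: (b^*) n0 n1 => c n0 n1; field.
by rewrite n0 /= (_ : _ + _ = 1 - c * b) //; ring.
Qed.

Lemma mobNK b z : normc b < 1 -> normc z < 1 -> mob b (mob (- b) z) = z.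
Proof. by move=> b1 z1; rewrite -{1}[b]opprK mobK // normcN. Qed.

Lemma mob_cdiff b z : 1 - b^* * z != 0 ->
  cdiff (mob b) z ((1 - b^* * b) / (1 - b^* * z) ^+ 2).
Proof.
move=> n0; have h1 := @cdiff_affine R (- b) 1 z; have h2 := @cdiff_affine R 1 (- b^*) z.
have n0' : 1 + - b^* * z != 0 by rewrite mulNr.
have := cdiffM h1 (cdiff_comp h2 (cdiffV n0')).
rewrite (_ : (fun w => _) = mob b); last first.
  by apply/funext => w; rewrite /mob /= mul1r mulNr [- b + w]addrC.
congr (cdiff _ _ _); rewrite /= mulNr.
by move: (b^*) n0 => c n0; field.
Qed.

Definition self_map (f : R[i] -> R[i]) := forall z, normc z < 1 ->
  normc (f z) < 1 /\ exists A, cdiff f z A.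

Lemma self_map_mob b : normc b < 1 -> self_map (mob b).
Proof.
move=> b1 z z1; split; first exact: mob_lt1.
by eexists; apply: mob_cdiff; exact: mob_den.
Qed.

Lemma self_map_comp f g : self_map f -> self_map g -> self_map (f \o g).
Proof.
move=> Hf Hg z /Hg[g1 [A gA]]; have [f1 [B fB]] := Hf _ g1.
by split => //; eexists; apply: cdiff_comp gA fB.
Qed.

(** Composing with [mob] on both sides moves [z] and [f z] to 0; [schwarz_derivative] bounds the
    derivative of the composite. *)
Lemma pick f z A : self_map f -> normc z < 1 -> cdiff f z A ->
  normc A * (1 - normc z ^+ 2) <= 1 - normc (f z) ^+ 2.
Proof.
move=> Hf z1 fA; have [fz1 _] := Hf z z1.
have Nz1 : normc (- z) < 1 by rewrite normcN.
have n01 : normc (0 : R[i]) < 1 by rewrite normc0.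
have m0 : mob (- z) 0 = z by rewrite mob0 opprK.
have n1 : 1 - (- z)^* * 0 != 0 by rewrite mulr0 subr0 oner_neq0.
have h1 := mob_cdiff n1; have n2 := one_sub_norm_neq0 fz1.
have fA' : cdiff f (mob (- z) 0) A by rewrite m0.
have n2' : 1 - (f z)^* * (f \o mob (- z)) 0 != 0 by rewrite /= m0.
have h2 := cdiff_comp (cdiff_comp h1 fA') (mob_cdiff n2').
have Hs : self_map (mob (f z) \o (f \o mob (- z))).
  by apply: self_map_comp (self_map_mob fz1) (self_map_comp Hf (self_map_mob Nz1)).
have Hs1 w : normc w < 1 -> normc ((mob (f z) \o (f \o mob (- z))) w) <= 1.
  by move=> /Hs[/ltW].
have Hs2 w : normc w < 1 -> exists B, cdiff (mob (f z) \o (f \o mob (- z))) w B.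
  by move=> /Hs[].
have := schwarz_derivative Hs1 Hs2 _ h2.
rewrite /= m0 mobb => /(_ erefl).
have lt1 w : normc w < 1 -> 0 < 1 - normc w ^+ 2.
  by move=> w1; rewrite subr_gt0 expr_lt1 ?normc_ge0.
have nn w : normc w < 1 -> normc (1 - w^* * w) = 1 - normc w ^+ 2.
  move=> w1; rewrite mulconj -[1](rmorph1 (real_complex R)) -rmorphB normc_realp //.
  exact/ltW/lt1.
rewrite mulr0 subr0 expr1n divr1.
set q := 1 - (f z)^* * f z; have -> : q / q ^+ 2 = q^-1 by field.
rewrite 2!normcM normcV /q (nn _ fz1) (nn _ Nz1) normcN mulrC.
by rewrite ler_pdivrMr ?lt1 // mul1r.
Qed.

(** Let [y t] be the component of [f] in the direction of [f z], taken along the radius to [z];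
    unlike the modulus it is differentiable everywhere. By [pick], [y' (1 - t^2) <= 1 - y^2], so
    artanh y - artanh t does not increase from its value 0 at [t = 0]. *)
Lemma schwarz f z : self_map f -> f 0 = 0 -> normc z < 1 -> normc (f z) <= normc z.
Proof.
move=> Hf f0 z1; pose s := normc z; have s0 : 0 <= s := normc_ge0 z.
pose e := (unimod z)^-1; have e1 : normc e = 1 by rewrite normcV normc_unimod invr1.
have ze : z = s%:C * e by rewrite /s -unimodM /e mulrAC divff ?mul1r // unimod_neq0.
pose c := unimod (f z); have c1 : normc c = 1 := normc_unimod _.
pose x t := f (t%:C * e); pose y (t : R) := Re (c * x t).
have ne t : 0 <= t -> normc (t%:C * e) = t.
  by move=> t0; rewrite normcM e1 mulr1 normc_realp.
have yx t : `|y t| <= normc (x t).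
  rewrite -[leRHS]mul1r -c1 -normcM /y ler_norml Re_le_normc andbT.
  by rewrite lerNl -raddfN; apply: le_trans (Re_le_normc _) _; rewrite normcN.
have x1 t : 0 <= t -> t <= s -> normc (x t) < 1.
  by move=> t0 ts; have [] := Hf (t%:C * e); rewrite ?ne //; exact: le_lt_trans ts z1.
have y1 t : 0 <= t -> t <= s -> `|y t| < 1.
  by move=> t0 ts; apply: le_lt_trans (yx t) (x1 t t0 ts).
have /choice[y' Hy'] : forall t : R, exists d : R, 0 <= t -> t <= s ->
    is_derive t 1 y d /\ d * (1 - t ^+ 2) <= 1 - y t ^+ 2.
  move=> t; have [t0|t0] := leP 0 t; last by exists 0.
  have [ts|ts] := leP t s; last by exists 0.
  have te1 : normc (t%:C * e) < 1 by rewrite ne //; exact: le_lt_trans ts z1.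
  have [_ [A fA]] := Hf _ te1; exists (Re (c * (A * e))) => _ _; split.
    apply: expand_is_derive => eps eps0; have [dl dl0 H] := fA _ eps0.
    exists dl => // u ud; have := H (u%:C * e).
    rewrite normcM e1 mulr1 normc_real => /(_ ud); apply: le_trans.
    rewrite /y /x rmorphD mulrDl.
    set f1 := f (_ + _); set f2 := f _.
    have -> : Re (c * f1) - Re (c * f2) - Re (c * (A * e)) * u =
        Re (c * (f1 - f2 - A * (u%:C * e))).
      have -> : Re (c * (A * e)) * u = Re (c * (A * e) * u%:C).
        by case: (c * (A * e)) => p q /=; ring.
      by rewrite -!raddfB; congr Re; ring.
    rewrite -[leRHS]mul1r -c1 -normcM ler_norml Re_le_normc andbT.
    by rewrite lerNl -raddfN; apply: le_trans (Re_le_normc _) _; rewrite normcN.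
  have t21 : 0 <= 1 - t ^+ 2.
    rewrite subr_ge0 exprn_ile1 //; exact: le_trans ts (ltW z1).
  apply: le_trans (ler_wpM2r t21 (Re_le_normc _)) _.
  rewrite 2!normcM c1 e1 mul1r mulr1.
  have := pick Hf te1 fA; rewrite ne // => h; apply: le_trans h _.
  rewrite lerD2l lerN2 -/(x t) -(real_normK (num_real (y t))).
  by rewrite ler_sqr ?nnegrE ?normc_ge0 // yx.
(* Twice the difference of artanh (y t) and artanh t. *)
pose W t := ln (1 + y t) - ln (1 - y t) - (ln (1 + t) - ln (1 - t)).
pose W' t := y' t / (1 + y t) + y' t / (1 - y t) - ((1 + t)^-1 + (1 - t)^-1).
have pos t : 0 <= t -> t <= s -> [/\ 0 < 1 + y t, 0 < 1 - y t, 0 < 1 + t & 0 < 1 - t].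
  move=> t0 ts; have := y1 t t0 ts; rewrite ltr_norml => /andP[? ?].
  by rewrite -/s in z1; split; lra.
have dW t : 0 <= t -> t <= s -> is_derive t 1 W (W' t).
  move=> t0 ts; have [p1 p2 p3 p4] := pos t t0 ts; have [dy _] := Hy' t t0 ts.
  have d1 : is_derive t 1 (fun t => ln (1 + y t)) (y' t / (1 + y t)).
    have h := is_deriveD (is_derive_cst (1 : R) t 1) dy; rewrite add0r in h.
    have := @is_derive1_comp _ (@ln R) (cst 1 + y) t _ _ (is_derive1_ln p1) h.
    by rewrite mulrC.
  have d2 : is_derive t 1 (fun t => ln (1 - y t)) (- (y' t / (1 - y t))).
    have h := is_deriveB (is_derive_cst (1 : R) t 1) dy; rewrite sub0r in h.
    have := @is_derive1_comp _ (@ln R) (cst 1 - y) t _ _ (is_derive1_ln p2) h.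
    by rewrite mulrN mulrC.
  have d3 : is_derive t 1 (fun t => ln (1 + t)) ((1 + t)^-1).
    have h := is_deriveD (is_derive_cst (1 : R) t 1) (is_derive_id t 1); rewrite add0r in h.
    have := @is_derive1_comp _ (@ln R) (cst 1 + id) t _ _ (is_derive1_ln p3) h.
    by rewrite mulr1.
  have d4 : is_derive t 1 (fun t => ln (1 - t)) (- (1 - t)^-1).
    have h := is_deriveB (is_derive_cst (1 : R) t 1) (is_derive_id t 1); rewrite sub0r in h.
    have := @is_derive1_comp _ (@ln R) (cst 1 - id) t _ _ (is_derive1_ln p4) h.
    by rewrite mulrN mulr1.
  have := is_deriveB (is_deriveB d1 d2) (is_deriveB d3 d4).
  by rewrite /W' !opprK.
have [||xi] := @MVT_segment _ W W' 0 s s0.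
- by move=> t; rewrite in_itv /= => /andP[/ltW t0 /ltW ts]; exact: dW.
- apply: continuous_in_subspaceT => t; rewrite inE /= in_itv /= => /andP[t0 ts].
  have [h _] := dW t t0 ts.
  exact/differentiable_continuous/derivable1_diffP.
rewrite in_itv /= => /andP[xi0 xis] eW.
have [p1 p2 p3 p4] := pos xi xi0 xis; have [_ hy] := Hy' xi xi0 xis.
have W'le : W' xi <= 0.
  have -> : W' xi = 2 * (y' xi * (1 - xi ^+ 2) - (1 - y xi ^+ 2)) /
     ((1 + y xi) * (1 - y xi) * ((1 + xi) * (1 - xi))).
    by rewrite /W'; field; rewrite !lt0r_neq0.
  by rewrite ler_pdivrMr ?mul0r ?mulr_gt0 //; lra.
have y0 : y 0 = 0 by rewrite /y /x rmorph0 mul0r f0 mulr0.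
have ys : y s = normc (f z) by rewrite /y /x -ze /c unimodM.
have W0 : W 0 = 0 by rewrite /W y0 subrr.
have Ws : W s <= 0.
  have : W s - W 0 <= 0 by rewrite eW mulr_le0_ge0 // subr0.
  by rewrite W0 subr0.
have [q1 q2 q3 q4] := pos s s0 (lexx s).
move: Ws; rewrite /W ys -/s => Ws; rewrite ys in q1 q2.
have : ln ((1 + normc (f z)) * (1 - s)) <= ln ((1 + s) * (1 - normc (f z))).
  by rewrite !lnM ?posrE //; lra.
rewrite ler_ln ?posrE ?mulr_gt0 //; lra.
Qed.

(** Schwarz for [f] and [g] shows that [f] preserves the modulus and the pseudo-hyperbolic distance,
    hence real inner products; comparison with the derivative at 0 then makes it linear. *)
Lemma automorphism_rotation f g : self_map f -> self_map g ->
  (forall z, normc z < 1 -> g (f z) = z) -> f 0 = 0 ->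
  exists2 A, normc A = 1 & forall z, normc z < 1 -> f z = A * z.
Proof.
move=> Hf Hg gf f0.
have n01 : normc (0 : R[i]) < 1 by rewrite normc0.
have g0 : g 0 = 0 by rewrite -{1}f0 gf.
have nf z : normc z < 1 -> normc (f z) = normc z.
  move=> z1; apply/eqP; rewrite eq_le schwarz // -{1}(gf z z1) schwarz //.
  by have [] := Hf z z1.
have mle h z w : self_map h -> normc z < 1 -> normc w < 1 ->
    normc (mob (h w) (h z)) <= normc (mob w z).
  move=> Hh z1 w1; have [hw1 _] := Hh w w1; have Nw1 : normc (- w) < 1 by rewrite normcN.
  have Hs : self_map (mob (h w) \o (h \o mob (- w))).
    by apply: self_map_comp (self_map_mob hw1) (self_map_comp Hh (self_map_mob Nw1)).
  have := @schwarz _ (mob w z) Hs; rewrite /= mob0 opprK mobb => /(_ erefl).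
  by move=> /(_ (mob_lt1 w1 z1)); rewrite mobK.
have inner z w : normc z < 1 -> normc w < 1 -> Re (f z * (f w)^*) = Re (z * w^*).
  move=> z1 w1; have [fz1 _] := Hf z z1; have [fw1 _] := Hf w w1.
  have meq : normc (mob (f w) (f z)) = normc (mob w z).
    apply/eqP; rewrite eq_le mle //=.
    by rewrite -{1}(gf z z1) -{1}(gf w w1) mle.
  (* As moduli are preserved, [mob_identity] reduces this to equal denominators, whose expansion
     contains the inner product. *)
  have : 1 - normc (mob (f w) (f z)) ^+ 2 = 1 - normc (mob w z) ^+ 2 by rewrite meq.
  rewrite !mob_identity // !nf //.
  have lt1 (v : R[i]) : normc v < 1 -> 0 < 1 - normc v ^+ 2.
    by move=> v1; rewrite subr_gt0 expr_lt1 ?normc_ge0.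
  move=> /(mulfI (lt0r_neq0 (mulr_gt0 (lt1 _ w1) (lt1 _ z1)))) /invr_inj.
  move=> den2.
  have expand (u v : R[i]) : normc (1 - v^* * u) ^+ 2 =
      1 - 2 * Re (u * v^*) + (normc u * normc v) ^+ 2.
    rewrite exprMn !sqr_normcE; case: u v => [a b] [c d] /=; simpc => /=; ring.
  by move: den2; rewrite !expand !nf //; lra.
have [_ [A fA]] := Hf 0 n01.
(* Take [w = t e] in [inner], divide by [t] and let [t] tend to 0. *)
have lim e z : normc e = 1 -> normc z < 1 -> Re (f z * (A * e)^*) = Re (z * e^*).
  move=> e1 z1; apply/eqP; rewrite -subr_eq0 -normr_le0; apply/ler_addgt0Pl => eps eps0.
  rewrite addr0; have [dl dl0 H] := fA _ eps0.
  pose t : R := Num.min (dl / 2) (1 / 2).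
  have t0 : 0 < t by rewrite lt_min !divr_gt0.
  have tdl : t < dl by apply: (@le_lt_trans _ _ (dl / 2)); [rewrite ge_min lexx|lra].
  have t1 : t < 1 by apply: (@le_lt_trans _ _ (1 / 2)); [rewrite ge_min lexx orbT|lra].
  have nt : normc (t%:C * e) = t by rewrite normcM e1 mulr1 normc_realp // ltW.
  have := H (t%:C * e); rewrite nt add0r f0 subr0 => /(_ tdl) h.
  have := @inner z (t%:C * e) z1; rewrite nt => /(_ t1) i1.
  rewrite -(ler_pM2r t0) -[X in _ * X <= _](gtr0_norm t0) -normrM.
  have -> : (Re (f z * (A * e)^*) - Re (z * e^*)) * t =
      - Re (f z * (f (t%:C * e) - A * (t%:C * e))^*).
    have reR (q : R[i]) : Re q * t = Re (q * t%:C) by case: q => a b /=; ring.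
    rewrite mulrBl !reR.
    have -> : Re (z * e^* * t%:C) = Re (z * (t%:C * e)^*).
      by rewrite conjcM conjcR; congr Re; ring.
    by rewrite -i1 -raddfB -raddfN conjcB !conjcM conjcR; congr Re; ring.
  rewrite normrN; set q := f z * _.
  have : `|Re q| <= normc q.
    rewrite ler_norml Re_le_normc andbT lerNl -raddfN.
    by apply: le_trans (Re_le_normc _) _; rewrite normcN.
  move=> /le_trans; apply; rewrite /q normcM normc_conj nf //.
  by apply: le_trans h; rewrite ler_piMl ?normc_ge0 // ltW.
(* The directions 1 and ['i] give the real and the imaginary part. *)
have fzA z : normc z < 1 -> f z * A^* = z.
  move=> z1; have := @lim 1 z (normc1 _) z1; rewrite mulr1 rmorph1 mulr1.
  have i1 : normc ('i%C : R[i]) = 1 by rewrite normc_im normr1.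
  have := @lim 'i%C z i1 z1; rewrite conjcM mulrA.
  case: (f z * A^*) => a b; case: (z) => x y.
  by rewrite /Num.conj /=; simpc => /= -> ->.
have A1 : normc A = 1.
  have h1 : normc ((1 / 2)%:C : R[i]) < 1 by rewrite normc_realp //; lra.
  have := congr1 (@normc R) (fzA _ h1); rewrite normcM normc_conj nf //.
  rewrite normc_realp //; lra.
exists A => // z z1; rewrite -{2}(fzA z z1) mulrC -mulrA mulconj A1.
by rewrite expr1n rmorph1 mulr1.
Qed.

Lemma automorphism_moebius (Psi : R[i] -> R[i]) : disk_automorphism Psi ->
  exists u b, [/\ normc u = 1, normc b < 1 &
    forall z, normc z < 1 -> Psi z = u * mob b z].
Proof.
move=> [Psi' [h1 h2 h3 h4 hd]].
have dE z : disk 0 1 z <-> normc z < 1 by rewrite /disk /= subr0.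
have HP : self_map Psi.
  move=> z /dE z1; split; first exact/dE/h1.
  by eexists; apply: cderivable_cdiff; have [] := hd z z1.
have HP' : self_map Psi'.
  move=> z /dE z1; split; first exact/dE/h2.
  by eexists; apply: cderivable_cdiff; have [] := hd z z1.
have n01 : normc (0 : R[i]) < 1 by rewrite normc0.
pose b := Psi' 0; have [b1 _] := HP' 0 n01; rewrite -/b in b1.
have Nb1 : normc (- b) < 1 by rewrite normcN.
have [||||A A1 HA] := @automorphism_rotation (Psi \o mob (- b)) (mob b \o Psi').
- exact: self_map_comp HP (self_map_mob Nb1).
- exact: self_map_comp (self_map_mob b1) HP'.
- move=> z z1 /=; have m1 := mob_lt1 Nb1 z1.
  by rewrite h3 ?inE ?dE // mobNK.
- by rewrite /= mob0 opprK h4 // inE dE.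
exists A, b; split => // z z1; have m1 := mob_lt1 b1 z1.
by rewrite -HA //= mobK.
Qed.

End DiskAutomorphisms.

(** * Transfer along Moebius maps *)

Section DiskCovers.
Variable R : realType.

(** Connectedness made explicit: a segment from the center to a point outside disk [i] has to cross
    a ring around that disk which none of the disks meets. *)
Lemma cdisk_in_one (I : finType) (c : I -> R[i]) (r : I -> R) (c0 : R[i]) (r0 : R) :
  0 <= r0 -> (forall i, 0 < r i) ->
  (forall i k, i != k -> cdisk (c i) (r i) `&` cdisk (c k) (r k) = set0) ->
  (forall z, cdisk c0 r0 z -> exists i, cdisk (c i) (r i) z) ->
  exists i, cdisk c0 r0 `<=` cdisk (c i) (r i).
Proof.
move=> r00 rp dis cov.
have [|i ci] := cov c0; first by rewrite /cdisk /= subrr normc0.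
exists i => z zc; rewrite /cdisk /=; rewrite leNgt; apply/negP => zi.
(* The width of the ring: the distance from disk [i] to [z] and to each other disk. At half the
   minimum the segment is in no disk. *)
pose g k : R := if k == i then normc (z - c i) - r i
                else normc (c i - c k) - r i - r k.
have gp k : 0 < g k.
  rewrite /g; case: eqVneq => [_|ki]; first by rewrite subr_gt0.
  have := disjoint_cdisk (rp i) (rp k) (dis i k _); rewrite eq_sym => /(_ ki); lra.
pose m := \big[Num.min/1]_k (g k).
have m0 : 0 < m by apply: lt_bigmin => // k _; exact: gp.
have mg k : m <= g k by exact: (bigmin_le 1 k g).
pose f (t : R) := normc (c0 + t%:C * (z - c0) - c i).
have f0 : f 0 <= r i by rewrite /f rmorph0 mul0r addr0.
have f1 : f 1 = normc (z - c i) by rewrite /f rmorph1; congr normc; ring.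
have fi : r i + m <= f 1 by have := mg i; rewrite /g eqxx f1; lra.
have lip s t : `|f s - f t| <= `|s - t| * normc (z - c0).
  have key s' t' : f s' - f t' <= `|s' - t'| * normc (z - c0).
    apply: le_trans (normcB_ge _ _) _; rewrite -normc_real -normcM rmorphB.
    by rewrite le_eqVlt; apply/orP; left; apply/eqP; congr normc; ring.
  by rewrite ler_norml key andbT lerNl opprB distrC key.
have fc : {within `[0, 1], continuous f}.
  apply: continuous_subspaceT => t; apply/cvgrPdist_lt => /= e e0.
  have n0 := normc_ge0 (z - c0).
  have e' : 0 < e / (normc (z - c0) + 1) by rewrite divr_gt0 // ltr_wpDl.
  near=> s.
  apply: le_lt_trans (lip t s) _.
  have : `|t - s| < e / (normc (z - c0) + 1).
    by near: s; apply: cvgr_dist_lt => //; exact: cvg_id.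
  rewrite ltr_pdivlMr ?ltr_wpDl //; apply: le_lt_trans.
  by rewrite ler_wpM2l // lerDl.
have [|t] := @IVT _ f 0 1 (r i + m / 2) ler01 fc.
  by rewrite ge_min le_max; apply/andP; split; apply/orP; [left|right]; lra.
rewrite in_itv /= => /andP[t0 t1] ft.
have [|k] := cov (c0 + t%:C * (z - c0)).
  rewrite /cdisk /= addrC addKr normcM normc_realp //.
  by apply: le_trans zc; rewrite ler_piMl ?normc_ge0.
rewrite /cdisk /=; have [->|ki] := eqVneq k i; first by rewrite -/(f t) ft; lra.
have := mg k; rewrite /g (negbTE ki) => h1 h2.
have := le_normc_triangle (c i) (c k) (c0 + t%:C * (z - c0)).
rewrite (normcBC (c i) (c0 + _)) -/(f t) ft; lra.
Unshelve. all: by end_near. Qed.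

(** Each disk lies in one of the other family, which lies in one of the first; by disjointness this
    is the disk at the start. *)
Lemma equal_unions_of_cdisks (I J : finType) (c : I -> R[i]) (r : I -> R)
    (c' : J -> R[i]) (r' : J -> R) :
  (forall i, 0 < r i) -> (forall j, 0 < r' j) ->
  (forall i k, i != k -> cdisk (c i) (r i) `&` cdisk (c k) (r k) = set0) ->
  (forall j k, j != k -> cdisk (c' j) (r' j) `&` cdisk (c' k) (r' k) = set0) ->
  (forall z, (exists i, cdisk (c i) (r i) z) <-> exists j, cdisk (c' j) (r' j) z) ->
  forall i, exists j, c i = c' j /\ r i = r' j.
Proof.
move=> rp rp' dis dis' un i.
have [j ij] : exists j, cdisk (c i) (r i) `<=` cdisk (c' j) (r' j).
  apply: cdisk_in_one => // [|z zi]; first exact: ltW.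
  by apply/un; exists i.
have [k jk] : exists k, cdisk (c' j) (r' j) `<=` cdisk (c k) (r k).
  apply: cdisk_in_one => // [|z zj]; first exact: ltW.
  by apply/un; exists j.
have ik : i = k.
  apply/eqP; apply: contrapT => /negP/dis/seteqP[sub _]; apply: (sub (c i)).
  have ci : cdisk (c i) (r i) (c i) by rewrite /cdisk /= subrr normc0 ltW.
  by split => //; exact/jk/ij.
exists j; apply: cdisk_inj => //; apply/seteqP; split => //.
by rewrite ik.
Qed.

End DiskCovers.

Section Rotation.
Variables (R : realType) (u b : R[i]).
Hypotheses (u1 : normc u = 1) (b1 : normc b < 1).
Implicit Types (a z : R[i]) (s : R).

Definition rmob z : R[i] := u * mob b z.

Let uu : u^* * u = 1. Proof. by rewrite mulconj u1 expr1n rmorph1. Qed.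

Lemma rmob_lt1 z : normc z < 1 -> normc (rmob z) < 1.
Proof. by move=> z1; rewrite normcM u1 mul1r mob_lt1. Qed.

Lemma rmob_sub z z' : normc z < 1 -> normc z' < 1 ->
  rmob z - rmob z' = u * (1 - b^* * b) * (z - z') /
    ((1 - b^* * z) * (1 - b^* * z')).
Proof.
move=> /(mob_den b1) n /(mob_den b1) n'; rewrite /rmob /mob.
by move: (b^*) n n' => c n n'; field; rewrite n n'.
Qed.

Let nbb : normc (1 - b^* * b) = 1 - normc b ^+ 2.
Proof.
rewrite mulconj -[1](rmorph1 (real_complex R)) -rmorphB normc_realp //.
by rewrite subr_ge0 exprn_ile1 ?normc_ge0 // ltW.
Qed.

Let nbb0 : 0 < 1 - normc b ^+ 2.
Proof. by rewrite subr_gt0 expr_lt1 ?normc_ge0. Qed.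

Lemma rmob_bilipschitz : exists c1 c2 : R, [/\ 0 < c1, 0 < c2 &
  forall z z', normc z < 1 -> normc z' < 1 ->
    c1 * normc (z - z') <= normc (rmob z - rmob z') <= c2 * normc (z - z')].
Proof.
pose k := 1 - normc b ^+ 2; have k0 : 0 < k := nbb0.
have d0 : 0 < 1 - normc b by rewrite subr_gt0.
(* In [rmob_sub] both denominators have modulus between [1 - |b|] and 2. *)
exists (k / 4), (k / (1 - normc b) ^+ 2); split; rewrite ?divr_gt0 ?exprn_gt0 //.
move=> z z' z1 z1'; rewrite rmob_sub // normcM normcV 2!normcM u1 mul1r nbb -/k.
have b0 := normc_ge0 b; have zz0 := normc_ge0 (z - z').
have lo w : normc w < 1 -> 1 - normc b <= normc (1 - b^* * w).
  move=> w1; apply: le_trans (one_sub_normc_ge _ _); rewrite normc_conj lerD2l lerN2.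
  by rewrite ler_piMr // ltW.
have hi w : normc w < 1 -> normc (1 - b^* * w) <= 2.
  move=> w1; apply: le_trans (one_sub_normc_le _ _) _; rewrite normc_conj.
  have : normc b * normc w <= normc b by rewrite ler_piMr // ltW.
  lra.
rewrite normcM; set p := normc (1 - _); set q := normc (1 - _).
have p0 : 0 < p by apply: lt_le_trans (lo z z1).
have q0 : 0 < q by apply: lt_le_trans (lo z' z1').
have pq0 : 0 < p * q by rewrite mulr_gt0.
rewrite ![_ / _ * normc (z - z')]mulrAC.
have kz : 0 <= k * normc (z - z') by rewrite mulr_ge0 // ltW.
apply/andP; split; apply: ler_wpM2l => //; rewrite lef_pV2 ?posrE ?exprn_gt0 //.
  have -> : 4 = 2 * 2 :> R by ring.
  by apply: ler_pM; rewrite ?(ltW p0) ?(ltW q0) ?hi.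
by rewrite expr2; apply: ler_pM; rewrite ?(ltW d0) ?lo.
Qed.

Lemma rmob_inj z z' : normc z < 1 -> normc z' < 1 -> rmob z = rmob z' -> z = z'.
Proof.
move=> z1 z1' e; have [c1 [c2 [c10 _ H]]] := rmob_bilipschitz.
have := H z z' z1 z1'; rewrite e subrr normc0 => /andP[+ _].
rewrite pmulr_rle0 // => h; apply/eqP; rewrite -subr_eq0 -normc_eq0.
by rewrite eq_le h normc_ge0.
Qed.

(** The factor is unimodular and independent of [z]: the first gives the image of a hole, the second
    the conjugation of the maps [T_]. *)
Lemma mob_rmob a z : normc a < 1 -> normc z < 1 ->
  mob (rmob a) (rmob z) = u * (1 - b * a^*) / (1 - b^* * a) * mob a z.
Proof.
move=> a1 z1; have nz := mob_den b1 z1; have na := mob_den b1 a1.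
have naz := mob_den a1 z1; have nbn := one_sub_norm_neq0 b1.
have nab : 1 - b * a^* != 0.
  by rewrite one_sub_neq0 // normc_conj mulr_ilt1 ?normc_ge0.
have den : 1 - (rmob a)^* * rmob z =
    (1 - b^* * b) * (1 - a^* * z) / ((1 - b * a^*) * (1 - b^* * z)).
  have -> : (rmob a)^* = u^* * ((a^* - b^*) / (1 - b * a^*)).
    rewrite /rmob conjcM /mob conjcM conjcB; congr (_ * (_ * _)).
    by rewrite conjcV conjcB rmorph1 conjcM conjCK.
  rewrite /rmob mulrACA uu mul1r /mob.
  move: (b^*) (a^*) nz nab => c d nz nab; field.
  by rewrite nab nz.
rewrite /mob -/(rmob z) -/(rmob a) den rmob_sub //.
move: (b^*) (a^*) nz na naz nbn nab => c d nz na naz nbn nab; field.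
by rewrite nz na naz nbn nab.
Qed.

Lemma normc_mob_rmob a z : normc a < 1 -> normc z < 1 ->
  normc (mob (rmob a) (rmob z)) = normc (mob a z).
Proof.
move=> a1 z1; rewrite mob_rmob // 2!normcM normcV normcM u1 mul1r.
have -> : normc (1 - b * a^*) = normc (1 - b^* * a).
  by rewrite -normc_conj conjcB rmorph1 conjcM conjCK.
by rewrite divff ?mul1r // normc_eq0 mob_den.
Qed.

Lemma cdisk_mob a s z : normc a < 1 -> 0 < s < 1 -> normc z < 1 ->
  cdisk (pcenter a s) (pradius a s) z <-> normc (mob a z) <= s.
Proof.
move=> a1 sP z1; rewrite /cdisk /= -hole_le // normc_mob ler_pdivrMr //.
by rewrite normc_gt0 mob_den.
Qed.

Lemma cdisk_rmob a s z : normc a < 1 -> 0 < s < 1 -> normc z < 1 ->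
  cdisk (pcenter (rmob a) s) (pradius (rmob a) s) (rmob z) <->
  cdisk (pcenter a s) (pradius a s) z.
Proof.
by move=> a1 sP z1; rewrite !cdisk_mob ?rmob_lt1 // normc_mob_rmob.
Qed.

Lemma mob_moeb a s z : normc a < 1 -> 0 < s < 1 -> normc z < 1 ->
  normc (moeb (pcenter a s) (pradius a s) z) < 1 /\
  mob a (moeb (pcenter a s) (pradius a s) z) = (s ^+ 2)%:C * mob a z.
Proof.
move=> a1 sP z1; have Na1 : normc (- a) < 1 by rewrite normcN.
have m1 : normc ((s ^+ 2)%:C * mob a z) < 1.
  case/andP: sP => s0 s1.
  rewrite normcM normc_realp ?sqr_ge0 // mulr_ilt1 ?sqr_ge0 ?normc_ge0 ?mob_lt1 //.
  by rewrite expr_lt1 // ltW.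
have e : moeb (pcenter a s) (pradius a s) z = mob (- a) ((s ^+ 2)%:C * mob a z).
  rewrite -Phi_inv_scaleE ?mulr_ilt1 ?normc_ge0 // /Phi_inv /Phi -/(mob a z).
  rewrite mulrCA [unimod a * _]mulrC mulfK ?unimod_neq0 //.
  by rewrite [RHS]/mob opprK conjcN mulNr opprK.
by rewrite e mobNK // mob_lt1.
Qed.

(** In the coordinate [mob a] the map is multiplication by [s ^+ 2], which commutes with the
    constant factor of [mob_rmob]. *)
Lemma moeb_rmob a s z : normc a < 1 -> 0 < s < 1 -> normc z < 1 ->
  moeb (pcenter (rmob a) s) (pradius (rmob a) s) (rmob z) =
  rmob (moeb (pcenter a s) (pradius a s) z).
Proof.
move=> a1 sP z1; have a1' := rmob_lt1 a1; have z1' := rmob_lt1 z1.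
have [h1 h2] := mob_moeb a1 sP z1; have [h3 h4] := mob_moeb a1' sP z1'.
rewrite -[LHS](mobK a1' h3) -[RHS](mobK a1' (rmob_lt1 h1)); congr (mob _ _).
by rewrite h4 !mob_rmob // h2 mulrCA.
Qed.

Lemma rmob_cdiff z : normc z < 1 -> exists A, cdiff rmob z A.
Proof.
move=> z1; have h := mob_cdiff (mob_den b1 z1).
have := cdiff_comp h (@cdiff_affine R 0 u (mob b z)).
rewrite (_ : _ \o _ = rmob); first by move=> h'; eexists; exact: h'.
by apply/funext => w; rewrite /= add0r.
Qed.

End Rotation.

Section RotationInverse.
Variables (R : realType) (u b : R[i]).
Hypotheses (u1 : normc u = 1) (b1 : normc b < 1).
Implicit Types z : R[i].

Let uu : u^* * u = 1. Proof. by rewrite mulconj u1 expr1n rmorph1. Qed.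

Lemma rmob_invE z : rmob u^-1 (- (u * b)) z = mob (- b) (u^-1 * z).
Proof.
have u0 : u != 0 by rewrite -normc_gt0 u1.
have uV : u^* = u^-1 by apply: (mulIf u0); rewrite uu mulVf.
rewrite /rmob /mob !conjcN conjcM uV !opprK !mulNr !opprK.
have -> : 1 + u^-1 * b^* * z = 1 + b^* * (u^-1 * z) by ring.
by rewrite (mulrA u^-1 (z + u * b)) mulrDr mulKf.
Qed.

Lemma rmob_invK z : normc z < 1 -> rmob u^-1 (- (u * b)) (rmob u b z) = z.
Proof.
have u0 : u != 0 by rewrite -normc_gt0 u1.
by move=> z1; rewrite rmob_invE /rmob mulKf // mobK.
Qed.

Lemma rmobK z : normc z < 1 -> rmob u b (rmob u^-1 (- (u * b)) z) = z.
Proof.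
have u0 : u != 0 by rewrite -normc_gt0 u1.
move=> z1; rewrite rmob_invE /rmob mobNK // ?mulVKf //.
by rewrite normcM normcV u1 invr1 mul1r.
Qed.

End RotationInverse.

Section Transfer.
Variables (R : realType) (u b : R[i]).
Hypotheses (u1 : normc u = 1) (b1 : normc b < 1).
Variables (D D' : cmcd R).

Lemma Tword_lt1 (E : cmcd R) (w : seq 'I_(holes E)) (z : R[i]) : normc z < 1 ->
  normc (Tword w z) < 1.
Proof. by move=> z1; elim: w => //= j w IH; apply: T_unit; exact: ltW. Qed.

(** Conjugate words are compared through the distance between the images of 0 and 1/2; [Tword_sub]
    and the distortion bounds convert it to derivatives at 0. Injectivity of [kappa] keeps distinct
    words distinct. *)
Lemma wsummable_transfer (kappa : 'I_(holes D) -> 'I_(holes D')) :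
  injective kappa ->
  (forall j z, normc z < 1 -> T_ j (rmob u b z) = rmob u b (T_ (kappa j) z)) ->
  wsummable D' -> wsummable D.
Proof.
move=> kinj kT [M HM].
have [c1 [c2 [c10 c20 H]]] := rmob_bilipschitz u1 b1.
have kTw w z : normc z < 1 -> Tword w (rmob u b z) = rmob u b (Tword (map kappa w) z).
  move=> z1; elim: w => //= j w ->.
  by rewrite kT // Tword_lt1.
pose h : R[i] := (1 / 2)%:C.
have nh : normc h = 1 / 2 by rewrite normc_realp //; lra.
have h1 : normc h < 1 by rewrite nh; lra.
have n01 : normc (0 : R[i]) < 1 by rewrite normc0.
have n0h : normc (0 - h) = 1 / 2 by rewrite sub0r normcN.
(* The 8 collects the distance 1/2 and two factors 1/2 from [sqDword_ge]. On the other side, the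
   distance 1/2 offsets the factor 2 that comes from [1 - rho / 2 >= 1 / 2]. *)
have key w : normc (sqDword w 0) ^+ 2 <=
    8 * c2 / c1 * normc (sqDword (map kappa w) 0) ^+ 2.
  have m0 := rmob_lt1 u1 b1 n01; have mh := rmob_lt1 u1 b1 h1.
  have e1 : normc (Tword w (rmob u b 0) - Tword w (rmob u b h)) =
     normc (rmob u b 0 - rmob u b h) * normc (sqDword w (rmob u b 0)) *
     normc (sqDword w (rmob u b h)).
    by rewrite Tword_sub ?unit_rho ?(ltW m0) ?(ltW mh) // 2!normcM.
  have low : c1 / 2 * (normc (sqDword w 0) / 2 * (normc (sqDword w 0) / 2)) <=
     normc (Tword w (rmob u b 0) - Tword w (rmob u b h)).
    rewrite e1 -(mulrA (normc (rmob u b 0 - rmob u b h))); apply: ler_pM.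
    - by rewrite divr_ge0 // ltW.
    - by rewrite mulr_ge0 // divr_ge0 // normc_ge0.
    - by have /andP[+ _] := H 0 h n01 h1; rewrite n0h mulrA mulr1.
    - apply: ler_pM; rewrite ?divr_ge0 ?normc_ge0 //.
        by have := sqDword_ge w (ltW m0); lra.
      by have := sqDword_ge w (ltW mh); lra.
  have h01 : rho D' * normc h < 1 by apply: unit_rho; exact: ltW.
  have z01 : rho D' * normc (0 : R[i]) < 1 by rewrite normc0 mulr0.
  have up : normc (Tword w (rmob u b 0) - Tword w (rmob u b h)) <=
     c2 * normc (sqDword (map kappa w) 0) ^+ 2.
    rewrite !kTw //.
    have /andP[_] := H _ _ (Tword_lt1 (map kappa w) n01) (Tword_lt1 (map kappa w) h1).
    move=> /le_trans; apply; rewrite ler_wpM2l ?(ltW c20) //.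
    rewrite Tword_sub // 2!normcM n0h expr2 mulrAC mulrC ler_wpM2l ?normc_ge0 //.
    have := sqDword_le (map kappa w) h01; rewrite nh.
    have := rho_lt1 D'; have := normc_ge0 (sqDword (map kappa w) h); nra.
  have := le_trans low up; set x := normc _; set y := _ ^+ 2 => xy.
  rewrite [8 * c2 / c1 * y]mulrAC ler_pdivlMr //; nra.
exists (8 * c2 / c1 * M) => s us.
apply: (@le_trans _ _ (\sum_(w <- s) 8 * c2 / c1 * normc (sqDword (map kappa w) 0) ^+ 2)).
  by apply: ler_sum => w _; exact: key.
rewrite -mulr_sumr ler_wpM2l ?divr_ge0 ?mulr_ge0 ?(ltW c10) ?(ltW c20) //.
rewrite -(big_map (map kappa) predT (fun w => normc (sqDword w 0) ^+ 2)).
by apply: HM; rewrite map_inj_uniq //; exact: inj_map.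
Qed.

Lemma hole_in_unit (E : cmcd R) (j : 'I_(holes E)) z :
  cdisk (center E j) (radius E j) z -> normc z < 1.
Proof. by move=> /(@hole_sub _ E); rewrite /disk /= subr0. Qed.

(** Complements in the unit disk show that the holes of [D] and the images of those of [D'] have the
    same union, so they agree one by one; [moeb_rmob] then conjugates the maps. *)
Lemma image_domain_matching : domain D = rmob u b @` domain D' ->
  exists2 kappa : 'I_(holes D) -> 'I_(holes D'), injective kappa &
    forall j z, normc z < 1 -> T_ j (rmob u b z) = rmob u b (T_ (kappa j) z).
Proof.
move=> dom.
pose M := rmob u b; pose M' := rmob (u^-1) (- (u * b)).
have iu1 : normc u^-1 = 1 by rewrite normcV u1 invr1.
have ub1 : normc (- (u * b)) < 1 by rewrite normcN normcM u1 mul1r.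
have MM' z : normc z < 1 -> normc (M' z) < 1 /\ M (M' z) = z.
  by move=> z1; split; [exact: rmob_lt1|exact: rmobK].
have domE (E : cmcd R) z : normc z < 1 ->
    (domain E z <-> ~ exists j, cdisk (center E j) (radius E j) z).
  move=> z1; split => [[_ nz] [j zj]|nz]; first by apply: nz; exists j.
  split; first by rewrite /disk /= subr0.
  by move=> [j _ zj]; apply: nz; exists j.
have holesE z : normc z < 1 -> ((exists j, cdisk (center D j) (radius D j) (M z)) <->
    exists i, cdisk (center D' i) (radius D' i) z).
  move=> z1; have Mz1 : normc (M z) < 1 by exact: rmob_lt1.
  split=> h; apply: contrapT => /[dup] nh.
    move=> /(domE _ _ z1) dz; have : domain D (M z) by rewrite dom; exists z.
    by move=> /(domE _ _ Mz1).
  move=> /(domE _ _ Mz1); rewrite dom => -[y dy Myz].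
  have y1 : normc y < 1 by have [+ _] := dy; rewrite /disk /= subr0.
  have yz : y = z by apply: (rmob_inj u1 b1 y1 z1).
  by move: dy; rewrite yz => /(domE _ _ z1).
pose c' (i : 'I_(holes D')) := pcenter (M (a_ i)) (sigma_ i).
pose r' (i : 'I_(holes D')) := pradius (M (a_ i)) (sigma_ i).
have imE i z : normc z < 1 -> (cdisk (c' i) (r' i) (M z) <->
    cdisk (center D' i) (radius D' i) z).
  have [a1 sP -> ->] := a_sigmaP i; exact: cdisk_rmob.
have im1 i z : cdisk (c' i) (r' i) z -> normc z < 1.
  have [a1 sP _ _] := a_sigmaP i.
  have := pcenter_pradius_lt1 (rmob_lt1 u1 b1 a1) sP.
  rewrite -/(c' i) -/(r' i) /cdisk /= => h1 h2.
  by have := normcB_ge z (c' i); lra.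
have r'0 i : 0 < r' i.
  by have [a1 sP _ _] := a_sigmaP i; apply: pradius_gt0 => //; exact: rmob_lt1.
have dis' i k : i != k -> cdisk (c' i) (r' i) `&` cdisk (c' k) (r' k) = set0.
  move=> ik; apply/seteqP; split => // z [zi zk].
  have [z'1 e] := MM' z (im1 _ _ zi); rewrite -e in zi zk.
  have /seteqP[sub _] := hole_disj ik; apply: (sub (M' z)).
  by split; [apply/(imE i)|apply/(imE k)].
have un z : (exists j, cdisk (center D j) (radius D j) z) <->
    exists i, cdisk (c' i) (r' i) z.
  split=> -[j zj].
    have [z'1 e] := MM' z (hole_in_unit zj); rewrite -e in zj *.
    have [i zi] := (holesE (M' z) z'1).1 (ex_intro _ j zj).
    by exists i; apply/(imE i).
  have [z'1 e] := MM' z (im1 _ _ zj); rewrite -e in zj *.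
  by apply/(holesE (M' z) z'1); exists j; apply/(imE j).
have /choice[kappa Hk] := equal_unions_of_cdisks (@radius_gt0 _ D) r'0
  (@hole_disj _ D) dis' un.
exists kappa => [j k jk|j z z1].
  apply/eqP; apply: contrapT => /negP/hole_disj/seteqP[sub _].
  have [e1 e2] := Hk j; have [e3 e4] := Hk k.
  apply: (sub (center D j)); rewrite e1 e2 e3 e4 -jk.
  by split; rewrite /cdisk /= subrr normc0 ltW.
have [cj rj] := Hk j; have [a1 sP ca ra] := a_sigmaP (kappa j).
rewrite !T_E ?unit_rho ?(ltW z1) ?(ltW (rmob_lt1 u1 b1 z1)) // cj rj ca ra.
exact: moeb_rmob.
Qed.

End Transfer.

(** * Condition (iii) and domains with at most two holes *)

Section ConditionIII.
Variable R : realType.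

Lemma condition_iii_wsummable (D : cmcd R) : condition_iii D -> wsummable D.
Proof.
move=> [D' [Psi [A' aut dom]]].
have [u [b [u1 b1 PE]]] := automorphism_moebius aut.
have domM : domain D = rmob u b @` domain D'.
  rewrite dom; apply/seteqP; split => _ [z dz <-]; exists z => //.
    by rewrite PE //; have [+ _] := dz; rewrite /disk /= subr0.
  by rewrite PE //; have [+ _] := dz; rewrite /disk /= subr0.
have [kappa kinj kT] := image_domain_matching u1 b1 domM.
apply: (wsummable_transfer u1 b1 kinj kT); exact: assumptionA_wsummable.
Qed.

Lemma rmob_automorphism (u b : R[i]) : normc u = 1 -> normc b < 1 ->
  disk_automorphism (rmob u b).
Proof.
move=> u1 b1; have dE (z : R[i]) : disk 0 1 z <-> normc z < 1 by rewrite /disk /= subr0.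
have iu1 : normc u^-1 = 1 by rewrite normcV u1 invr1.
have ub1 : normc (- (u * b)) < 1 by rewrite normcN normcM u1 mul1r.
exists (rmob u^-1 (- (u * b))); split.
- by move=> z /dE z1; apply/dE; exact: rmob_lt1.
- by move=> z /dE z1; apply/dE; exact: rmob_lt1.
- by move=> z; rewrite inE => /dE z1; exact: rmob_invK.
- by move=> z; rewrite inE => /dE z1; exact: rmobK.
move=> z /dE z1; have [A hA] := rmob_cdiff u b1 z1.
have [B hB] := rmob_cdiff u^-1 ub1 z1.
by split; [exact: cdiff_derivable hA|exact: cdiff_derivable hB].
Qed.

(** The new domain is the image of [D] under [rmob u b]; it is stated through the inverse map, the
    direction in which [condition_iii] reads. *)
Lemma exists_image_cmcd (D : cmcd R) (u b : R[i]) : normc u = 1 -> normc b < 1 ->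
  exists D' : cmcd R,
    (forall i, exists j : 'I_(holes D),
       center D' i = pcenter (rmob u b (a_ j)) (sigma_ j)) /\
    domain D = rmob u^-1 (- (u * b)) @` domain D'.
Proof.
move=> u1 b1; pose M := rmob u b; pose M' := rmob u^-1 (- (u * b)).
have iu1 : normc u^-1 = 1 by rewrite normcV u1 invr1.
have ub1 : normc (- (u * b)) < 1 by rewrite normcN normcM u1 mul1r.
have M'1 z : normc z < 1 -> normc (M' z) < 1 by exact: rmob_lt1.
have M1 z : normc z < 1 -> normc (M z) < 1 by exact: rmob_lt1.
have MM' z : normc z < 1 -> M (M' z) = z by exact: rmobK.
have M'M z : normc z < 1 -> M' (M z) = z by exact: rmob_invK.
pose c (j : 'I_(holes D)) := pcenter (M (a_ j)) (sigma_ j).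
pose r (j : 'I_(holes D)) := pradius (M (a_ j)) (sigma_ j).
have imE j z : normc z < 1 -> (cdisk (c j) (r j) (M z) <->
    cdisk (center D j) (radius D j) z).
  have [a1 sP -> ->] := a_sigmaP j; exact: cdisk_rmob.
have r0 j : 0 < r j.
  by have [a1 sP _ _] := a_sigmaP j; apply: pradius_gt0 => //; exact: M1.
have sub j : cdisk (c j) (r j) `<=` disk 0 1.
  have [a1 sP _ _] := a_sigmaP j.
  have := pcenter_pradius_lt1 (M1 _ a1) sP; rewrite -/(c j) -/(r j) => h1 z.
  by rewrite /cdisk /disk /= subr0 => h2; have := normcB_ge z (c j); lra.
have in1 j z : cdisk (c j) (r j) z -> normc z < 1.
  by move=> /sub; rewrite /disk /= subr0.
have dis i j : i != j -> cdisk (c i) (r i) `&` cdisk (c j) (r j) = set0.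
  move=> ij; apply/seteqP; split => // z [zi zj].
  have z1 := in1 _ _ zi; rewrite -(MM' z z1) in zi zj.
  have /seteqP[h _] := hole_disj ij; apply: (h (M' z)).
  by split; [apply/(imE i)|apply/(imE j)] => //; exact: M'1.
pose D' := Cmcd (holes_gt0 D) r0 sub dis.
exists D'; split; first by move=> j; exists j.
apply/seteqP; split => [z [z1 nz]|_ [z [z1 nz] <-]].
  have {}z1 : normc z < 1 by move: z1; rewrite /disk /= subr0.
  exists (M z); last exact: M'M.
  split; first by rewrite /disk /= subr0; exact: M1.
  by move=> [j _ zj]; apply: nz; exists j => //; apply/(imE j).
have {}z1 : normc z < 1 by move: z1; rewrite /disk /= subr0.
split; first by rewrite /disk /= subr0; exact: M'1.
move=> [j _ zj]; apply: nz; exists j => //.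
by rewrite -(MM' z z1); apply/(imE j) => //; exact: M'1.
Qed.

Lemma two_holes_condition_iii (D : cmcd R) :
  holes D = 1%N \/ holes D = 2%N -> condition_iii D.
Proof.
move=> h12; have last_lt : ((holes D).-1 < holes D)%N by rewrite prednK ?holes_gt0.
(* First and last hole; they coincide when there is only one, so both cases are treated together. *)
pose i0 : 'I_(holes D) := Ordinal (holes_gt0 D); pose i1 := Ordinal last_lt.
have cases j : j = i0 \/ j = i1.
  case: h12 => e; case: j => m /= lm.
    by left; apply: val_inj => /=; move: lm; rewrite e; case: m.
  have : (m < 2)%N by rewrite -e.
  case: m lm => [|[|m]] lm // _; first by left; exact: val_inj.
  by right; apply: val_inj; rewrite /= e.
have a01 := normc_a_lt1 i0; have a11 := normc_a_lt1 i1.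
(* [mob] sends [a_ i0] to 0, and this rotation then turns the image of [a_ i1] to the nonnegative
   real axis. The new centers are real multiples of these points. *)
pose u := unimod (mob (a_ i0) (a_ i1)); have u1 : normc u = 1 := normc_unimod _.
have Mreal (j : 'I_(holes D)) : exists x : R, rmob u (a_ i0) (a_ j) = x%:C.
  rewrite /rmob; case: (cases j) => ->; first by exists 0; rewrite mobb mulr0.
  by eexists; exact: unimodM.
have [D' [cD' dom]] := exists_image_cmcd D u1 a01.
have iu1 : normc u^-1 = 1 by rewrite normcV u1 invr1.
have ub1 : normc (- (u * a_ i0)) < 1 by rewrite normcN normcM u1 mul1r.
exists D', (rmob u^-1 (- (u * a_ i0))); split => //.
  apply/wsummable_assumptionA/condition_i_wsummable => i.
  have [j cj] := cD' i; have [x xE] := Mreal j.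
  pose v := x * ((1 - sigma_ j ^+ 2) / (1 - normc (x%:C : R[i]) ^+ 2 * sigma_ j ^+ 2)).
  have cv : center D' i = v%:C.
    by rewrite cj xE; symmetry; exact: (rmorphM (real_complex R)).
  exists v => //; rewrite -ltr_norml; have := holes_in_unit i.
  by rewrite cv normc_real; have := radius_gt0 i; lra.
exact: rmob_automorphism.
Qed.

End ConditionIII.

Theorem proposition1p2 (R : realType) (D : cmcd R) :
  (condition_i D \/ condition_ii D \/ condition_iii D -> assumptionA D) /\
  (holes D = 1%N \/ holes D = 2%N -> condition_iii D).
Proof.
split; last exact: two_holes_condition_iii.
move=> h; apply: wsummable_assumptionA; case: h => [|[]].
- exact: condition_i_wsummable.
- exact: condition_ii_wsummable.
- exact: condition_iii_wsummable.
Qed.
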